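(* Let $(S,\mathcal{A},\mu)$ be a complete, $\sigma$-finite measure space. If $E$ is an order continuous Köthe function space over $(S,\mathcal{A},\mu)$ with the property $(u^+)$ (in particular, if $E$ is UR) and $X$ is a uacs Banach space, then $E(X)$ is also uacs.
   Context: All Banach spaces are real. For a Banach space $X$, $X^*$ denotes its dual, $B_X$ its closed unit ball and $S_X$ its unit sphere. A Banach space $X$ is called: - UR (uniformly rotund) if for any two sequences $(x_n)$, $(y_n)$ in $S_X$, $\|x_n+y_n\|\to2$ implies $\|x_n-y_n\|\to0$; - uacs (uniformly alternatively convex or smooth) if for all sequences $(x_n)$, $(y_n)$ in $S_X$ and $(x_n^* )$ in $S_{X^*}$: $\|x_n+y_n\|\to2$ and $x_n^*(x_n)\to1$ imply $x_n^*(y_n)\to1$. A Köthe function space over a complete, $\sigma$-finite measure space $(S,\mathcal{A},\mu)$ is a Banach space $(E,\|\cdot\|_E)$ of real-valued measurable functions on $S$ modulo equality $\mu$-a.e. such that: (i) $\chi_A\in E$ for every $A\in\mathcal{A}$ with $\mu(A)<\infty$; (ii) every $f\in E$ is $\mu$-integrable over every $A\in\mathcal{A}$ with $\mu(A)<\infty$; (iii) if $g$ is measurable and $f\in E$ with $|g(t)|\le|f(t)|$ $\mu$-a.e., then $g\in E$ and $\|g\|_E\le\|f\|_E$. With the order $f\le g$ iff $f(t)\le g(t)$ $\mu$-a.e., $E$ is a Banach lattice; $E$ is order continuous if every decreasing net in $E$ with infimum zero is norm-convergent to zero. The Köthe dual $E'$ is the space of all measurable $g:S\to\mathbb{R}$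 (modulo equality a.e.) with $\|g\|_{E'}:=\sup\{\int_S|fg|\,\mathrm{d}\mu:f\in B_E\}<\infty$. An order continuous Köthe function space $E$ has property $(u^+)$ if for every $\varepsilon>0$ there is some $\delta>0$ such that for all $f,g\in S_E$ and every $h\in S_{E'}$: $\|f+g\|_E\ge2(1-\delta)$ and $\int_S fh\,\mathrm{d}\mu=1$ imply $\int_S|h||f-g|\,\mathrm{d}\mu\le\varepsilon$. For a Köthe function space $E$ and a Banach space $X$, the Köthe-Bochner space $E(X)$ is the Banach space of all Bochner-measurable functions $f:S\to X$ (modulo equality a.e.) with $\|f(\cdot)\|\in E$, normed by $\|f\|_{E(X)}=\|\,\|f(\cdot)\|\,\|_E$; Bochner-measurable means being the $\mu$-a.e. norm limit of a sequence of simple functions. *)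

(* Defs.v *)
From HB Require Import structures.
From mathcomp Require Import all_boot all_order all_algebra.
From mathcomp Require Import all_classical all_reals all_analysis.
From mathcomp Require Import measurable_realfun.

Set Implicit Arguments.
Unset Strict Implicit.
Unset Printing Implicit Defensive.

Import Order.TTheory GRing.Theory Num.Theory numFieldNormedType.Exports.

Local Open Scope classical_set_scope.
Local Open Scope ring_scope.

(* Rotundity notions only involve the norm, hence are stated for normed modules;
   a Banach space is a [completeNormedModType]. *)
Section geometry.
Context {R : realType} (X : normedModType R).

Definition dual_norm (phi : X -> R) : \bar R :=
  ereal_sup [set `|phi x|%:E | x in [set x : X | `|x| <= 1]].

Definition dual_sphere (phi : {linear X -> R^o}) : Prop :=
  continuous phi /\ dual_norm phi = 1%E.

Definition UR : Prop :=
  forall x y : nat -> X,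
    (forall n, `|x n| = 1) -> (forall n, `|y n| = 1) ->
    `|x n + y n| @[n --> \oo] --> (2 : R) ->
    `|x n - y n| @[n --> \oo] --> (0 : R).

Definition uacs : Prop :=
  forall (x y : nat -> X) (phi : nat -> {linear X -> R^o}),
    (forall n, `|x n| = 1) -> (forall n, `|y n| = 1) ->
    (forall n, dual_sphere (phi n)) ->
    `|x n + y n| @[n --> \oo] --> (2 : R) ->
    (phi n (x n) : R) @[n --> \oo] --> (1 : R) ->
    (phi n (y n) : R) @[n --> \oo] --> (1 : R).

End geometry.

Section kothe_space.
Context {d : measure_display} {S : measurableType d} {R : realType}.

(* The points of a Koethe function space are classes of functions modulo
   almost everywhere equality; [rep f] is a representative of the class f.
   By [rep_inj] a class is determined by its representative, so that "the
   function g belongs to E" reads [exists h : E, rep h = g %[ae mu]]. *)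
Record kothe_space (mu : {measure set S -> \bar R}) := KotheSpace {
  kothe_sort :> completeNormedModType R ;
  rep : kothe_sort -> S -> R ;
  rep_measurable : forall f, measurable_fun setT (rep f) ;
  rep_inj : forall f g, rep f = rep g %[ae mu] -> f = g ;
  rep_linear : forall (a : R) (f g : kothe_sort),
    rep (a *: f + g) = (fun t => a * rep f t + rep g t) %[ae mu] ;
  kothe_indic : forall A, measurable A -> (mu A < +oo)%E ->
    exists f, rep f = \1_A %[ae mu] ;
  kothe_integrable : forall f A, measurable A -> (mu A < +oo)%E ->
    mu.-integrable A (EFin \o rep f) ;
  kothe_ideal : forall (f : kothe_sort) (g : S -> R),
    measurable_fun setT g ->
    (\forall t \ae mu, `|g t| <= `|rep f t|) ->
    exists2 h, rep h = g %[ae mu] & `|h| <= `|f|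
}.

Context {mu : {measure set S -> \bar R}} (E : kothe_space mu).

Definition in_kothe (g : S -> R) : Prop := exists f : E, rep f = g %[ae mu].

(* The class of g in E; the value is 0 when g does not belong to E. *)
Definition kothe_class (g : S -> R) : E :=
  xget 0 [set f : E | rep f = g %[ae mu]].

Definition kothe_le (f g : E) : Prop := \forall t \ae mu, rep f t <= rep g t.

Definition order_continuous : Prop :=
  forall (I : Type) (leI : I -> I -> Prop),
    inhabited I -> (forall i, leI i i) ->
    (forall i j k, leI i j -> leI j k -> leI i k) ->
    (forall i j, exists k, leI i k /\ leI j k) ->
  forall u : I -> E,
    (forall i j, leI i j -> kothe_le (u j) (u i)) ->
    (forall i, kothe_le 0 (u i)) ->
    (forall v, (forall i, kothe_le v (u i)) -> kothe_le v 0) ->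
  forall e : R, 0 < e -> exists i, forall j, leI i j -> `|u j| <= e.

Definition kothe_dual_norm (h : S -> R) : \bar R :=
  ereal_sup [set (\int[mu]_t `|rep f t * h t|%:E)%E
            | f in [set f : E | `|f| <= 1]].

Definition kothe_dual_sphere (h : S -> R) : Prop :=
  measurable_fun setT h /\ kothe_dual_norm h = 1%E.

Definition property_u_plus : Prop :=
  forall e : R, 0 < e -> exists2 delta : R, 0 < delta &
    forall (f g : E) (h : S -> R),
      `|f| = 1 -> `|g| = 1 -> kothe_dual_sphere h ->
      `|f + g| >= 2 * (1 - delta) ->
      (\int[mu]_t (rep f t * h t)%:E = 1)%E ->
      (\int[mu]_t (`|h t| * `|rep f t - rep g t|)%:E <= e%:E)%E.

Lemma rep_ae f g (a : R) :
  \forall t \ae mu, rep (a *: f + g : E) t = a * rep f t + rep g t.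
Proof. by apply: filterS (rep_linear a f g) => t; apply. Qed.

Lemma rep0 : \forall t \ae mu, rep (0 : E) t = 0.
Proof.
have := rep_ae (0 : E) 0 (-1); rewrite scaler0 addr0.
by apply: filterS => t ->; rewrite mulN1r addNr.
Qed.

Lemma repD (f g : E) : \forall t \ae mu, rep (f + g) t = rep f t + rep g t.
Proof.
by have := rep_ae f g 1; rewrite scale1r; apply: filterS => t; rewrite mul1r.
Qed.

Lemma repZ (a : R) (f : E) : \forall t \ae mu, rep (a *: f) t = a * rep f t.
Proof.
have := rep_ae f 0 a; rewrite addr0; apply: filterS2 rep0 => t -> ->.
by rewrite addr0.
Qed.

Lemma kothe_classE g (f : E) : rep f = g %[ae mu] -> kothe_class g = f.
Proof.
move=> fg; apply: rep_inj; rewrite /kothe_class.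
case: xgetP => [x _ xg|/(_ f)]; last by [].
by apply: filterS2 xg fg => t /= xg fg tT; rewrite xg// fg.
Qed.

Lemma kothe_classP g : in_kothe g ->
  \forall t \ae mu, rep (kothe_class g) t = g t.
Proof.
by move=> [f fg]; rewrite (kothe_classE fg); apply: filterS fg => t; apply.
Qed.

Lemma kothe_norm_le (f g : E) :
  (\forall t \ae mu, `|rep f t| <= `|rep g t|) -> `|f| <= `|g|.
Proof.
by move=> /(kothe_ideal (rep_measurable f))[h hf]; rewrite (rep_inj hf).
Qed.

End kothe_space.

Arguments rep0 {d S R mu} E.
Arguments in_kothe {d S R mu} E g.
Arguments order_continuous {d S R mu} E.
Arguments kothe_dual_norm {d S R mu} E h.
Arguments kothe_dual_sphere {d S R mu} E h.
Arguments property_u_plus {d S R mu} E.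

Section bochner_measurable.
Context {d : measure_display} {S : measurableType d} {R : realType}.
Context (mu : {measure set S -> \bar R}) {X : normedModType R}.
Implicit Types f g : S -> X.

(* The library's [{sfun S >-> _}] requires a sigma-algebra on the codomain;
   here measurability of the fibres suffices, the range being finite. *)
Definition simple f : Prop :=
  finite_set (range f) /\ forall x, measurable (f @^-1` [set x]).

Definition bochner_measurable f : Prop :=
  exists s : nat -> S -> X, (forall n, simple (s n)) /\
    \forall t \ae mu, s n t @[n --> \oo] --> f t.

Lemma simple_comb a f g : simple f -> simple g ->
  simple (fun t => a *: f t + g t).
Proof.
move=> [ff mf] [fg mg]; split.
  apply: (sub_finite_set _ (finite_image2 (fun x y => a *: x + y) ff fg)).
  by move=> _ [t _ <-]; exists (f t); [exists t|exists (g t); [exists t|]].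
move=> x; rewrite [X in measurable X](_ : _ = \bigcup_(y in range f)
  (f @^-1` [set y] `&` g @^-1` [set x - a *: y])).
  by apply: fin_bigcup_measurable => // y _; exact: measurableI.
apply/seteqP; split=> [t /= <-|t [_ [u _ <-] [/= -> ->]]].
  by exists (f t); [exists t|split=> //=; rewrite addrC addKr].
by rewrite addrC subrK.
Qed.

Lemma simple_norm f : simple f -> measurable_fun setT (fun t => `|f t|).
Proof.
move=> [ff mf] _ B mB; rewrite setTI [X in measurable X](_ : _ =
  \bigcup_(y in range f `&` [set y | B `|y|]) f @^-1` [set y]).
  by apply: fin_bigcup_measurable => //; exact: finite_setIl.
apply/seteqP; split=> [t /= Bt|t [_ [[u _ <-] /= Bu] /= ->]]//.
by exists (f t) => //; split=> //; exists t.
Qed.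

Lemma bochner_comb a f g : bochner_measurable f -> bochner_measurable g ->
  bochner_measurable (fun t => a *: f t + g t).
Proof.
move=> [s [s_simple sf]] [r [r_simple rg]].
exists (fun n t => a *: s n t + r n t); split=> [n|]; first exact: simple_comb.
by apply: filterS2 sf rg => t sf rg; apply: cvgD => //; exact: cvgZl_tmp.
Qed.

Lemma bochner_cst x : bochner_measurable (fun=> x).
Proof.
exists (fun _ _ => x); split=> [n|]; last by apply: aeW => t; exact: cvg_cst.
split; first exact: finite_image_cst.
by move=> y; rewrite preimage_cst; case: ifP.
Qed.

Lemma bochner_norm f : bochner_measurable f ->
  exists2 h, measurable_fun setT h & \forall t \ae mu, h t = `|f t|.
Proof.
move=> [s [s_simple sf]].
pose u t := limn_esup (fun n => `|s n t|%:E).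
have mu_ : measurable_fun setT u.
  apply: (@measurable_fun_limn_esup _ _ _ _ (fun n t => `|s n t|%:E)) => n.
  by apply/measurable_EFinP; exact: simple_norm.
exists (fine \o u).
  exact: (measurableT_comp (fine_measurable measurableT) mu_).
apply: filterS sf => t sf /=.
have sfE : `|s n t|%:E @[n --> \oo] --> `|f t|%:E.
  by apply: cvg_EFin; [exact: nearW|exact: cvg_norm].
by rewrite /u (cvg_limn_einf_sup sfE).
Qed.

End bochner_measurable.

Section kothe_bochner.
Context {d : measure_display} {S : measurableType d} {R : realType}.
Context {mu : {measure set S -> \bar R}}.
Variables (E : kothe_space mu) (X : normedModType R).

Definition kothe_bochner_pred : {pred S -> X} := mem [set f : S -> X |
  bochner_measurable mu f /\ in_kothe E (fun t => `|f t|)].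

Lemma kothe_bochner_submod_closed : submod_closed kothe_bochner_pred.
Proof.
split=> [|a f g].
  rewrite inE; split; first exact: bochner_cst.
  by exists 0; apply: filterS (rep0 E) => t -> _; rewrite normr0.
rewrite !inE => -[bf [u uf]] [bg [v vg]].
have bfg : bochner_measurable mu (a *: f + g) by exact: bochner_comb.
split=> //; have [h mh hfg] := bochner_norm bfg.
have [w wh _] : exists2 w : E, rep w = h %[ae mu] & `|w| <= `| `|a| *: u + v|.
  apply: (kothe_ideal mh).
  have := hfg; apply: filter_app; apply: filterS3 (rep_ae u v `|a|) uf vg.
  move=> t -> /(_ I) -> /(_ I) -> ->.
  by rewrite normr_id ger0_norm ?addr_ge0 ?mulr_ge0// -normrZ ler_normD.
by exists w; apply: filterS2 wh hfg => t wh hfg tT; rewrite wh.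
Qed.

HB.instance Definition _ := GRing.isSubmodClosed.Build R (S -> X)
  kothe_bochner_pred kothe_bochner_submod_closed.

Record kothe_bochner_fun := KotheBochnerFun {
  kothe_bochner_val :> S -> X ;
  _ : kothe_bochner_val \in kothe_bochner_pred }.

HB.instance Definition _ := [isSub for kothe_bochner_val].
HB.instance Definition _ := [Choice of kothe_bochner_fun by <:].
HB.instance Definition _ := [SubChoice_isSubLmodule of kothe_bochner_fun by <:].

Definition kothe_bochner_equiv (f g : kothe_bochner_fun) : bool :=
  `[< \forall t \ae mu, f t = g t >].

Lemma kothe_bochner_equiv_refl : reflexive kothe_bochner_equiv.
Proof. by move=> f; apply/asboolP/aeW. Qed.

Lemma kothe_bochner_equiv_sym : symmetric kothe_bochner_equiv.
Proof. by move=> f g; apply: asbool_equiv_eq; split; exact: filterS. Qed.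

Lemma kothe_bochner_equiv_trans : transitive kothe_bochner_equiv.
Proof.
move=> g f h /asboolP fg /asboolP gh; apply/asboolP.
by apply: filterS2 fg gh => t ->.
Qed.

Canonical kothe_bochner_equiv_rel := EquivRel kothe_bochner_equiv
  kothe_bochner_equiv_refl kothe_bochner_equiv_sym kothe_bochner_equiv_trans.

Local Open Scope quotient_scope.

(* The points of E(X) are the functions of [kothe_bochner_fun] modulo almost
   everywhere equality, with the norm [kb_norm] below. *)
Definition kothe_bochner : Type := {eq_quot kothe_bochner_equiv}.
HB.instance Definition _ := Choice.on kothe_bochner.
HB.instance Definition _ := EqQuotient.on kothe_bochner.

Implicit Types (F G H : kothe_bochner) (f g : kothe_bochner_fun).

Lemma repr_pi_ae f : \forall t \ae mu, repr (\pi_kothe_bochner f) t = f t.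
Proof.
have /eqP := reprK (\pi_kothe_bochner f); rewrite eqmodE.
by move/asboolP; exact: filterS.
Qed.

Lemma kothe_bochnerP F G : (\forall t \ae mu, repr F t = repr G t) -> F = G.
Proof.
move=> FG; rewrite -[F]reprK -[G]reprK; apply/eqP; rewrite eqmodE.
exact/asboolP.
Qed.

Definition kb_class f : kothe_bochner := \pi f.
Definition kb_zero := kb_class 0.
Definition kb_opp F := kb_class (- repr F).
Definition kb_add F G := kb_class (repr F + repr G).
Definition kb_scale (a : R) F := kb_class (a *: repr F).
Definition kb_norm F : R := `|kothe_class E (fun t => `|repr F t|)|.

Lemma repr_zero : \forall t \ae mu, repr kb_zero t = 0.
Proof. exact: repr_pi_ae. Qed.

Lemma repr_opp F : \forall t \ae mu, repr (kb_opp F) t = - repr F t.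
Proof. exact: repr_pi_ae. Qed.

Lemma repr_add F G : \forall t \ae mu, repr (kb_add F G) t = repr F t + repr G t.
Proof. exact: repr_pi_ae. Qed.

Lemma repr_scale a F : \forall t \ae mu, repr (kb_scale a F) t = a *: repr F t.
Proof. exact: repr_pi_ae. Qed.

Lemma kb_addA : associative kb_add.
Proof.
move=> F G H; apply: kothe_bochnerP.
have := repr_add F (kb_add G H); apply: filter_app.
apply: filterS3 (repr_add G H) (repr_add (kb_add F G) H) (repr_add F G).
by move=> t -> -> -> ->; rewrite addrA.
Qed.

Lemma kb_addC : commutative kb_add.
Proof.
move=> F G; apply: kothe_bochnerP.
by apply: filterS2 (repr_add F G) (repr_add G F) => t -> ->; rewrite addrC.
Qed.

Lemma kb_add0r : left_id kb_zero kb_add.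
Proof.
move=> F; apply: kothe_bochnerP.
by apply: filterS2 (repr_add kb_zero F) repr_zero => t -> ->; rewrite add0r.
Qed.

Lemma kb_addNr : left_inverse kb_zero kb_opp kb_add.
Proof.
move=> F; apply: kothe_bochnerP.
apply: filterS3 (repr_add (kb_opp F) F) (repr_opp F) repr_zero => t -> -> ->.
by rewrite addNr.
Qed.

HB.instance Definition _ := GRing.isZmodule.Build kothe_bochner
  kb_addA kb_addC kb_add0r kb_addNr.

Lemma kb_scalerA a b F : kb_scale a (kb_scale b F) = kb_scale (a * b) F.
Proof.
apply: kothe_bochnerP; apply: filterS3 (repr_scale a (kb_scale b F))
  (repr_scale b F) (repr_scale (a * b) F) => t -> -> ->.
by rewrite scalerA.
Qed.

Lemma kb_scale1r : left_id 1 kb_scale.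
Proof.
move=> F; apply: kothe_bochnerP; apply: filterS (repr_scale 1 F) => t ->.
by rewrite scale1r.
Qed.

Lemma kb_scalerDr : right_distributive kb_scale +%R.
Proof.
move=> a F G; apply: kothe_bochnerP.
have := repr_scale a (kb_add F G); apply: filter_app.
have := repr_add (kb_scale a F) (kb_scale a G); apply: filter_app.
apply: filterS3 (repr_add F G) (repr_scale a F) (repr_scale a G).
by move=> t FG aF aG -> ->; rewrite FG aF aG scalerDr.
Qed.

Lemma kb_scalerDl F : {morph kb_scale^~ F : a b / a + b}.
Proof.
move=> a b; apply: kothe_bochnerP.
have := repr_add (kb_scale a F) (kb_scale b F); apply: filter_app.
apply: filterS3 (repr_scale (a + b) F) (repr_scale a F) (repr_scale b F).
by move=> t -> aF bF ->; rewrite aF bF scalerDl.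
Qed.

HB.instance Definition _ := GRing.Zmodule_isLmodule.Build R kothe_bochner
  kb_scalerA kb_scale1r kb_scalerDr kb_scalerDl.

Lemma kothe_class_repr F : \forall t \ae mu,
  rep (kothe_class E (fun t => `|repr F t|)) t = `|repr F t|.
Proof. by apply: kothe_classP; have := valP (repr F); rewrite inE => -[]. Qed.

Lemma kb_ler_normD F G : kb_norm (F + G) <= kb_norm F + kb_norm G.
Proof.
apply: (le_trans _ (ler_normD _ _)); apply: kothe_norm_le.
have := kothe_class_repr (F + G); apply: filter_app.
have := repD (kothe_class E (fun t => `|repr F t|))
  (kothe_class E (fun t => `|repr G t|)); apply: filter_app.
apply: filterS3 (repr_add F G) (kothe_class_repr F) (kothe_class_repr G).
move=> t FG rF rG -> ->; rewrite FG rF rG.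
by rewrite normr_id ger0_norm ?addr_ge0// ler_normD.
Qed.

Lemma kb_normrZ a F : kb_norm (a *: F) = `|a| * kb_norm F.
Proof.
have aF : rep (`|a| *: kothe_class E (fun t => `|repr F t|)) =
    (fun t => `|repr (a *: F) t|) %[ae mu].
  apply: filterS3 (repZ `|a| (kothe_class E (fun t => `|repr F t|)))
    (kothe_class_repr F) (repr_scale a F) => t -> -> aF _.
  by rewrite aF normrZ.
by rewrite /kb_norm (kothe_classE aF) normrZ normr_id.
Qed.

Lemma kb_normr0_eq0 F : kb_norm F = 0 -> F = 0.
Proof.
move=> /normr0_eq0 F0; apply: kothe_bochnerP.
have := kothe_class_repr F; rewrite F0 => rF.
apply: filterS3 rF (rep0 E) repr_zero => t -> /eqP.
by rewrite normr_eq0 => /eqP -> ->.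
Qed.

HB.instance Definition _ := Lmodule_isNormed.Build R kothe_bochner
  kb_ler_normD kb_normrZ kb_normr0_eq0.

End kothe_bochner.

(* Main.v *)
From HB Require Import structures.
Require Import Defs.
From mathcomp Require Import all_boot all_order all_algebra.
From mathcomp Require Import all_classical all_reals all_analysis.
From mathcomp Require Import measurable_realfun.
From mathcomp Require Import lra.

(** The functionals on E(X) need not be described. If [phi] is a functional of
    norm one with [phi x] close to 1, then
      [t * phi y = phi x - phi (x - t *: y) >= phi x - `|x - t *: y|],
    so a Banach space is uacs as soon as, for unit vectors [x], [y] with
    [`|x + y|] close to 2, the norm decreases from [x] to [x - t *: y] by nearly
    [t], for one fixed small [t > 0] ([uacs_of_slope]). This criterion speaks of
    norms only. Conversely, in a uacs space a functional that norms [x - t *: y]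
    is almost 1 at [y], and this yields a quantitative decrease for all pairs
    of vectors, with an error term controlled by [`| `|x| - `|y| |] and
    [`|x| + `|y| - `|x + y|] ([uacs_slope]).

    In E(X), let [c] be the modulus of [F - t *: G] and [p] its normalization.
    Order continuity of E gives a weight [h >= 0] on the unit sphere of the
    Koethe dual with [\int p h = 1] ([kothe_norming]). The normalized modulus of
    [F + G] and the modulus of [G] form with [p] pairs of unit vectors whose sums
    have norm almost 2, so property (u+) says that they agree with [p] up to a
    small error in [L^1(h)]; the modulus of [F] does so because it is close to [c]
    in norm. Hence the error term of [uacs_slope], taken pointwise in X, has small
    integral against [h], and integrating the pointwise inequality gives the
    decrease of the norm in E(X) ([kothe_pair_slope], [slope_kothe_bochner]).

    The weight [h] is the Radon-Nikodym density of [A |-> l (p 1_A)] divided by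
    [p], where [l] is a positive functional that norms [p]; order continuity of E
    is what makes this set function countably additive. Positivity comes from
    applying the Hahn-Banach theorem to the sublinear map [f |-> `|f^+|].

    If E is UR, a decreasing net of nonnegative elements has converging norms,
    hence is Cauchy by uniform rotundity, and its limit is its infimum
    ([UR_order_continuous]); property (u+) is uniform rotundity combined with
    Hoelder's inequality ([UR_property_u_plus]). *)

Set Implicit Arguments.
Unset Strict Implicit.
Unset Printing Implicit Defensive.

Import Order.TTheory GRing.Theory Num.Theory numFieldNormedType.Exports.

Local Open Scope classical_set_scope.
Local Open Scope ring_scope.

(** * The Hahn-Banach theorem *)

Section hahn_banach.
Context {R : realType} {V : lmodType R}.
Implicit Types p q : V -> R.

(** One inequality suffices for homogeneity, since it can be applied to the
    inverse scalar; see [sublinearZ]. *)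
Definition sublinear p :=
  (forall x y, p (x + y) <= p x + p y) /\
  (forall a x, 0 < a -> p (a *: x) <= a * p x).

Lemma sublinear0 p : sublinear p -> p 0 = 0.
Proof.
move=> [_ ph]; have := ph 2 0 (ltr0Sn _ _); have := ph 2^-1 0.
by rewrite !scaler0 invr_gt0 ltr0Sn => /(_ isT); lra.
Qed.

Lemma sublinearZ p a x : sublinear p -> 0 <= a -> p (a *: x) = a * p x.
Proof.
move=> sp; rewrite le_eqVlt => /predU1P[<-|a0].
  by rewrite scale0r mul0r sublinear0.
apply/eqP; rewrite eq_le (sp.2 a x a0)/=.
have := sp.2 a^-1 (a *: x).
rewrite invr_gt0 a0 scalerA mulVf ?gt_eqF// scale1r => /(_ isT).
by rewrite ler_pdivlMl.
Qed.

Lemma sublinear_oppr p x : sublinear p -> - p (- x) <= p x.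
Proof.
by move=> sp; have := sp.1 x (- x); rewrite subrr sublinear0//; lra.
Qed.

(** The infimum over [t >= 0] of [q (x + t *: y) - t * q y] is the largest
    sublinear map below [q] whose value at [- y] is at most [- q y]; the latter is
    the choice [t = 1]. *)
Lemma sublinear_pinch q y : sublinear q -> exists q',
  [/\ sublinear q', forall x, q' x <= q x & q' (- y) <= - q y].
Proof.
move=> sq.
pose S x := [set q (x + t *: y) - t * q y | t in [set t : R | 0 <= t]].
have lbS x : lbound (S x) (- q (- x)).
  move=> _ [t /= t0 <-]; rewrite -sublinearZ//.
  have := sq.1 (x + t *: y) (- x); rewrite addrC addKr; lra.
have S0 x : S x !=set0 by exists (q (x + 0 *: y) - 0 * q y); exists 0 => /=.
have infS x t : 0 <= t -> inf (S x) <= q (x + t *: y) - t * q y.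
  by move=> t0; apply: ge_inf; [exists (- q (- x))|exists t].
exists (fun x => inf (S x)); split.
- split=> [x z|a x a0] /=.
  + rewrite -lerBlDr; apply: lb_le_inf => // _ [t /= t0 <-].
    rewrite lerBlDr -lerBlDl; apply: lb_le_inf => // _ [u /= u0 <-].
    rewrite lerBlDl; have := infS (x + z) (t + u) (addr_ge0 t0 u0).
    move/le_trans; apply; have := sq.1 (x + t *: y) (z + u *: y).
    by rewrite addrACA -scalerDl; lra.
  + rewrite -ler_pdivrMl//; apply: lb_le_inf => // _ [t /= t0 <-].
    rewrite ler_pdivrMl//; have := infS (a *: x) (a * t) (mulr_ge0 (ltW a0) t0).
    move/le_trans; apply; rewrite -scalerA -scalerDr.
    by rewrite (sublinearZ _ sq (ltW a0)); lra.
- by move=> x; have := infS x 0 (lexx _); rewrite scale0r mul0r addr0 subr0.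
- by have := infS (- y) 1 ler01; rewrite scale1r addNr sublinear0// mul1r sub0r.
Qed.

(** Zorn's lemma: the pointwise infimum of a chain of sublinear maps below [p] is
    finite, because all of them are at least [- p (- x)], and it is sublinear. *)
Lemma sublinear_minimal p : sublinear p -> exists q,
  [/\ sublinear q, forall x, q x <= p x &
      forall r, sublinear r -> (forall x, r x <= q x) -> r = q].
Proof.
move=> sp; pose T := {q : V -> R | `[< sublinear q /\ forall x, q x <= p x >]}.
pose le (s t : T) := `[< forall x, sval t x <= sval s x >].
have TP (t : T) : sublinear (sval t) /\ forall x, sval t x <= p x.
  exact/asboolP/(svalP t).
have [||r s||t tmax] := @Zorn T le.
- by move=> t; apply/asboolP => x.
- move=> r s t /asboolP rs /asboolP st; apply/asboolP => x.
  exact: le_trans (st x) (rs x).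
- move=> /asboolP rs /asboolP sr; apply: val_inj; apply/funext => x /=.
  by apply/eqP; rewrite eq_le rs sr.
- move=> A totA; have [[s0 As0]|A0] := pselect (A !=set0); last first.
    have pT : `[< sublinear p /\ forall x, p x <= p x >] by apply/asboolP.
    by exists (exist _ p pT) => s As; exfalso; apply: A0; exists s.
  pose S x := [set sval s x | s in A].
  have lbS x : lbound (S x) (- p (- x)).
    move=> _ [s As <-]; have := sublinear_oppr x (TP s).1.
    by apply: le_trans; rewrite lerN2; exact: (TP s).2.
  have S0 x : S x !=set0 by exists (sval s0 x); exists s0.
  have infS x s : A s -> inf (S x) <= sval s x.
    by move=> As; apply: ge_inf; [exists (- p (- x))|exists s].
  have iT : `[< sublinear (fun x => inf (S x)) /\ forall x, inf (S x) <= p x >].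
    apply/asboolP; split=> [|x]; last first.
      exact: le_trans (infS _ _ As0) ((TP _).2 _).
    split=> [x z|a x a0] /=.
    + rewrite -lerBlDr; apply: lb_le_inf => // _ [s As <-].
      rewrite lerBlDr -lerBlDl; apply: lb_le_inf => // _ [u Au <-].
      rewrite lerBlDl; have [/asboolP su|/asboolP us] := totA _ _ As Au.
        apply: (le_trans (infS _ _ Au)); apply: (le_trans ((TP u).1.1 _ _)).
        by rewrite lerD2r.
      apply: (le_trans (infS _ _ As)); apply: (le_trans ((TP s).1.1 _ _)).
      by rewrite lerD2l.
    + rewrite -ler_pdivrMl//; apply: lb_le_inf => // _ [s As <-].
      rewrite ler_pdivrMl//; apply: (le_trans (infS _ _ As)).
      exact: (TP s).1.2.
  exists (exist _ (fun x => inf (S x)) iT) => s As.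
  by apply/asboolP => x /=; exact: infS.
exists (sval t); have [st tp] := TP t; split=> // r sr rt.
have rT : `[< sublinear r /\ forall x, r x <= p x >].
  by apply/asboolP; split=> // x; exact: le_trans (rt x) (tp x).
by rewrite -(tmax (exist _ r rT))//; exact/asboolP.
Qed.

Lemma odd_sublinear_linear q : sublinear q -> (forall y, q (- y) = - q y) ->
  linear (q : V -> R^o).
Proof.
move=> sq qN; have qZ a x : q (a *: x) = a * q x.
  have [a0|a0] := leP 0 a; first exact: sublinearZ.
  rewrite -[a]opprK scaleNr qN sublinearZ// ?mulNr//.
  by rewrite oppr_ge0 ltW.
have qD x y : q (x + y) = q x + q y.
  apply/eqP; rewrite eq_le sq.1/=.
  by have := sq.1 (x + y) (- y); rewrite addrK qN; lra.
by move=> a x y; rewrite qD qZ.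
Qed.

(** A minimal sublinear map cannot be pinched further, so it is odd, hence linear.
    Pinching [p] at [x0] first forces the value at [x0]. *)
Theorem hahn_banach p (x0 : V) : sublinear p ->
  exists2 f : {linear V -> R^o}, (forall x, f x <= p x) & f x0 = p x0.
Proof.
move=> sp; have [p' [sp' p'p p'x0]] := sublinear_pinch x0 sp.
have [q [sq qp' qmin]] := sublinear_minimal sp'.
have qN y : q (- y) = - q y.
  have [r [sr rq ry]] := sublinear_pinch y sq.
  rewrite (qmin _ sr rq) in ry; apply/eqP; rewrite eq_le ry/=.
  by have := sublinear_oppr (- y) sq; rewrite opprK.
have ql := odd_sublinear_linear sq qN.
pose qm := GRing.isLinear.Build R V R^o *:%R q ql.
pose f : {linear V -> R^o} := HB.pack q qm.
exists f => [x|]; first exact: le_trans (qp' x) (p'p x).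
apply/eqP; rewrite eq_le; apply/andP; split.
  exact: le_trans (qp' x0) (p'p x0).
by have := le_trans (qp' _) p'x0; rewrite qN lerN2.
Qed.

End hahn_banach.

(** * Quantitative forms of UR and uacs *)

Section functionals.
Context {R : realType} {X : normedModType R}.
Implicit Types (x y : X) (phi : {linear X -> R^o}).

Lemma dual_sphere_le phi x : dual_sphere phi -> `|phi x : R| <= `|x|.
Proof.
move=> [_ phi1]; have [->|x0] := eqVneq x 0; first by rewrite linear0 !normr0.
have : (`|phi (`|x|^-1 *: x) : R|%:E <= dual_norm phi)%E.
  apply: ereal_sup_ubound; exists (`|x|^-1 *: x) => //=.
  by rewrite normrZ ger0_norm ?invr_ge0// mulVf ?normr_eq0.
rewrite phi1 lee_fin linearZ/= normrM ger0_norm ?invr_ge0//.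
by rewrite ler_pdivrMl ?normr_gt0// mulr1.
Qed.

Lemma norming_functional x : x != 0 ->
  exists2 phi : {linear X -> R^o}, dual_sphere phi & phi x = `|x|.
Proof.
move=> x0; have [|phi phi_le phix] := @hahn_banach R X (fun x => `|x|) x.
  split=> [y z|a y a0]; first exact: ler_normD.
  by rewrite normrZ gtr0_norm.
have phi_norm y : `|phi y : R| <= `|y|.
  by rewrite ler_norml phi_le andbT lerNl -linearN/= -normrN phi_le.
exists phi => //; split.
  move=> y; apply/cvgrPdist_le => e e0.
  have /cvgrPdist_le/(_ e e0) : z @[z --> y] --> y by exact: cvg_id.
  by apply: filterS => z; apply: le_trans; rewrite -linearB; exact: phi_norm.
apply/eqP; rewrite eq_le; apply/andP; split.
  apply: ub_ereal_sup => _ [y /= y1 <-]; rewrite lee_fin.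
  exact: le_trans (phi_norm y) y1.
apply: ereal_sup_ubound; exists (`|x|^-1 *: x) => /=.
  by rewrite normrZ ger0_norm ?invr_ge0// mulVf ?normr_eq0.
rewrite linearZ/= phix; congr EFin.
by rewrite normrM normr_id ger0_norm ?invr_ge0// mulVf ?normr_eq0.
Qed.

Lemma norm_sum_cvg2 (x y : nat -> X) :
  (forall n, `|x n| = 1) -> (forall n, `|y n| = 1) ->
  (forall n, 2 - n.+1%:R^-1 <= `|x n + y n|) ->
  `|x n + y n| @[n --> \oo] --> (2 : R).
Proof.
move=> x1 y1 xy.
apply: (@squeeze_cvgr _ _ _ _ (fun n => 2 - n.+1%:R^-1) (fun=> 2)).
- apply: nearW => n; rewrite xy/=; apply: (le_trans (ler_normD _ _)).
  by rewrite x1 y1.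
- rewrite -[X in _ --> X]subr0.
  by apply: cvgB; [exact: cvg_cst|exact: cvg_harmonic].
- exact: cvg_cst.
Qed.

Lemma UR_modulus : UR X ->
  forall e : R, 0 < e -> exists2 delta : R, 0 < delta &
  forall x y, `|x| = 1 -> `|y| = 1 -> 2 - delta <= `|x + y| -> `|x - y| <= e.
Proof.
move=> urX e e0; apply: contrapT => /forall2NP noD.
have /choice[xy xyP] (n : nat) : exists xy : X * X, [/\ `|xy.1| = 1, `|xy.2| = 1,
    2 - n.+1%:R^-1 <= `|xy.1 + xy.2| & e < `|xy.1 - xy.2|].
  have [|/existsNP[x /existsNP[y]]] := noD n.+1%:R^-1; first by rewrite invr_gt0.
  move=> /not_implyP[x1 /not_implyP[y1 /not_implyP[xy /negP]]].
  by rewrite -ltNge => exy; exists (x, y).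
have := urX (fun n => (xy n).1) (fun n => (xy n).2).
have x1 n : `|(xy n).1| = 1 by case: (xyP n).
have y1 n : `|(xy n).2| = 1 by case: (xyP n).
move=> /(_ x1 y1 (norm_sum_cvg2 x1 y1 _)) xy0.
have /xy0 : forall n, 2 - n.+1%:R^-1 <= `|(xy n).1 + (xy n).2|.
  by move=> n; case: (xyP n).
move=> /cvgrPdist_lt/(_ e e0)[N _ /(_ N (leqnn N))]/=.
by rewrite sub0r normrN normr_id ltNge; case: (xyP N) => _ _ _ /ltW ->.
Qed.

(** Letting [y] range over the ball costs nothing: [`|x + y|] close to 2 forces
    [`|y|] to be close to 1, so that [y] can be normalized. *)
Lemma UR_modulus_ball : UR X ->
  forall e : R, 0 < e -> exists2 delta : R, 0 < delta &
  forall x y, `|x| = 1 -> `|y| <= 1 -> 2 - delta <= `|x + y| -> `|x - y| <= e.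
Proof.
move=> urX e e0; have e20 : 0 < e / 2 by rewrite divr_gt0.
have [dl dl0 H] := UR_modulus urX e20.
pose d := Num.min (Num.min (dl / 2) (e / 2)) (1 / 2).
have [d1 d2 d3] : [/\ d <= dl / 2, d <= e / 2 & d <= 1 / 2].
  by split; rewrite /d !ge_min lexx ?orbT.
exists d => [|x y x1 y1 xy]; first by rewrite !lt_min !divr_gt0.
have := ler_normD x y; rewrite x1 => xyle.
have y0 : 0 < `|y| by lra.
pose y' := `|y|^-1 *: y.
have y'1 : `|y'| = 1 by rewrite normrZ ger0_norm ?invr_ge0// mulVf ?gt_eqF.
have yy' : `|y' - y| <= d.
  rewrite -[X in _ - X]scale1r -scalerBl normrZ -[X in _ * X]normr_id -normrM.
  by rewrite mulrBl mulVf ?gt_eqF// mul1r ger0_norm; lra.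
have : `|x - y| <= `|x - y'| + `|y' - y|.
  by have := ler_normD (x - y') (y' - y); rewrite addrA subrK.
have : `|x + y| <= `|x + y'| + `|y' - y|.
  by have := ler_normB (x + y') (y' - y); rewrite opprB addrA addrAC addrK.
have := H x y' x1 y'1; lra.
Qed.

(** Functionals that attain their norm at [x] are enough here: in [uacs_slope]
    the point is chosen first and the functional norms it. *)
Lemma uacs_modulus : uacs X ->
  forall e : R, 0 < e -> exists2 delta : R, 0 < delta &
  forall x y phi, `|x| = 1 -> `|y| = 1 -> dual_sphere phi -> phi x = 1 ->
  2 - delta <= `|x + y| -> 1 - e <= phi y.
Proof.
move=> uX e e0; apply: contrapT => /forall2NP noD.
have /choice[z zP] (n : nat) : exists z : X * X * {linear X -> R^o},
    [/\ `|z.1.1| = 1 /\ `|z.1.2| = 1, dual_sphere z.2, z.2 z.1.1 = 1,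
    2 - n.+1%:R^-1 <= `|z.1.1 + z.1.2| & z.2 z.1.2 < 1 - e :> R].
  have [|/existsNP[x /existsNP[y /existsNP[phi]]]] := noD n.+1%:R^-1.
    by rewrite invr_gt0.
  move=> /not_implyP[x1 /not_implyP[y1 /not_implyP[p1 /not_implyP[px]]]].
  move=> /not_implyP[xy /negP].
  by rewrite -ltNge => exy; exists (x, y, phi).
have x1 n : `|(z n).1.1| = 1 by case: (zP n) => -[].
have y1 n : `|(z n).1.2| = 1 by case: (zP n) => -[].
have := uX (fun n => (z n).1.1) (fun n => (z n).1.2) (fun n => (z n).2) x1 y1.
have p1 n : dual_sphere (z n).2 by case: (zP n).
have xy n : 2 - n.+1%:R^-1 <= `|(z n).1.1 + (z n).1.2| by case: (zP n).
have zx : (fun n => (z n).2 (z n).1.1 : R) = fun=> 1.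
  by apply/funext => n; case: (zP n).
move=> /(_ p1 (norm_sum_cvg2 x1 y1 xy)); rewrite zx => /(_ (cvg_cst _)).
move=> /cvgrPdist_lt/(_ e e0)[N _ /(_ N (leqnn N))]/=.
case: (zP N) => _ _ _ _ zN; rewrite ltr_norml => /andP[_]; lra.
Qed.

(** A decrease of the norm by [t * (1 - e)] bounds every functional that is close
    to 1 at [x], whether or not it attains its norm: this replaces the
    Bishop-Phelps-Bollobas theorem in the passage from exact to approximate
    norming. *)
Lemma uacs_of_slope :
  (forall e : R, 0 < e -> exists t delta : R, [/\ 0 < t, 0 < delta &
     forall x y, `|x| = 1 -> `|y| = 1 -> 2 - delta <= `|x + y| ->
       `|x - t *: y| <= 1 - t * (1 - e)]) ->
  uacs X.
Proof.
move=> slope x y phi x1 y1 phi1 xy phix; apply/cvgrPdist_le => e e0.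
have e20 : 0 < e / 2 by rewrite divr_gt0.
have [t [delta [t0 delta0 H]]] := slope _ e20.
near=> n.
have : phi n (y n) <= 1 :> R.
  by rewrite (le_trans (ler_norm _))// -(y1 n); exact: dual_sphere_le.
have : 2 - delta <= `|x n + y n|.
  near: n; move/cvgrPdist_le : xy => /(_ _ delta0); apply: filterS => n.
  by rewrite ler_norml => /andP[]; lra.
move=> /(H _ _ (x1 n) (y1 n)) Hn.
have : 1 - t * (e / 2) <= phi n (x n).
  near: n; move/cvgrPdist_le : phix => /(_ _ (mulr_gt0 t0 e20)).
  apply: filterS => n.
  by rewrite ler_norml => /andP[]; lra.
have : phi n (x n - t *: y n) <= `|x n - t *: y n| :> R.
  by rewrite (le_trans (ler_norm _))//; exact: dual_sphere_le.
rewrite linearB linearZ/= => phixy phix_ge phiy_le.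
suff : 1 - e <= phi n (y n) by move=> phiy_ge; rewrite ler_norml; lra.
rewrite -(ler_pM2l t0).
have tE : t *: phi n (y n) = t * (phi n (y n) : R) by [].
rewrite tE in phixy; nra.
Unshelve. all: by end_near. Qed.

(** For [t] small and [x], [y] nearly extremal for the triangle inequality and of
    nearly equal norms, [x - t *: y] and [y] are still nearly extremal, so a
    functional norming [z = x - t *: y] is at least [(1 - e) * `|y|] at [y], and
    evaluating it at [x = z + t *: y] gives the decrease. For all other pairs the
    error term, multiplied by [K], is at least [2 * `|y|], and the trivial bound
    [`|x - t *: y| <= `|x| + t * `|y|] suffices. The constants do not depend on
    [t], which must later be taken small with respect to [K]. *)
Lemma uacs_slope : uacs X -> forall e : R, 0 < e -> exists t0 K : R,
  [/\ 0 < t0, 0 < K & forall x y t, 0 < t -> t <= t0 ->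
    t * ((1 - e) * `|y| - K * (`| `|x| - `|y| | + (`|x| + `|y| - `|x + y|)))
      <= `|x| - `|x - t *: y| ].
Proof.
move=> uX e e0; have [d0 d00 H] := uacs_modulus uX e0.
(* For [z = x - t *: y] with [t <= g], the sum of the normalized [z] and [y] has
   norm at least [2 - 2 * g - 2 * t]; that [5 * g <= 1] makes [z] nonzero. *)
pose g : R := Num.min d0 1 / 5.
have g0 : 0 < g by rewrite divr_gt0// lt_min d00 ltr01.
have [gd g1] : 5 * g <= d0 /\ 5 * g <= 1.
  have -> : 5 * g = Num.min d0 1 by rewrite mulrC divfK.
  by rewrite !ge_min !lexx orbT.
exists g, (2 / g); split=> // [|x y t t0 tg]; first by rewrite divr_gt0.
set u := `|x| + `|y| - `|x + y|; set v := `| `|x| - `|y| |.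
have u0 : 0 <= u by rewrite subr_ge0 ler_normD.
have v0 : 0 <= v by exact: normr_ge0.
have xty : `|x| - t * `|y| <= `|x - t *: y|.
  by rewrite -[X in X * _](gtr0_norm t0) -normrZ lerB_dist.
have xty' : `|x - t *: y| <= `|x| + t * `|y|.
  by rewrite -[X in X * _](gtr0_norm t0) -normrZ ler_normB.
have [bad|good] := leP (g * `|y|) (v + u).
  have : 2 * `|y| <= 2 / g * (v + u) by rewrite -mulrA ler_pM2l// ler_pdivlMl.
  have := normr_ge0 y; nra.
have y0 : 0 < `|y|.
  rewrite lt_neqAle eq_sym normr_ge0 andbT; apply/eqP => y0.
  by move: good; rewrite y0; lra.
have vxy : `|y| - v <= `|x| <= `|y| + v.
  by have := lexx v; rewrite {1}/v ler_norml => /andP[]; lra.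
set z := x - t *: y.
have z0 : 0 < `|z| by rewrite /z; nra.
have [|phi phi1 phiz] := @norming_functional z; first by rewrite -normr_gt0.
have nz : `| `|z|^-1 *: z| = 1.
  by rewrite normrZ ger0_norm ?invr_ge0// mulVf ?gt_eqF.
have ny : `| `|y|^-1 *: y| = 1.
  by rewrite normrZ ger0_norm ?invr_ge0// mulVf ?gt_eqF.
have phinz : phi (`|z|^-1 *: z) = 1.
  by rewrite linearZ/= phiz; apply: mulVf; rewrite gt_eqF.
have := H _ _ phi nz ny phi1 phinz.
have -> : phi (`|y|^-1 *: y) = `|y|^-1 * (phi y : R) by rewrite linearZ.
rewrite ler_pdivlMl// => phiy.
have {}phiy : `|y| * (1 - e) <= phi y.
  apply: phiy; rewrite -(ler_pM2l y0) -[X in X * `|_ + _|]ger0_norm//.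
  rewrite -normrZ scalerDr !scalerA mulfV ?gt_eqF// scale1r.
  have : `|z + y| <= `|(`|y| * `|z|^-1) *: z + y| + `| `|z| - `|y| |.
    have -> : z + y = ((`|y| * `|z|^-1) *: z + y) + (1 - `|y| * `|z|^-1) *: z.
      by rewrite scalerBl scale1r [RHS]addrC addrA subrK.
    apply: (le_trans (ler_normD _ _)).
    rewrite lerD2l normrZ -[X in _ * X]ger0_norm//.
    by rewrite -normrM mulrBl mul1r -mulrA mulVf ?gt_eqF// mulr1.
  have : `| `|z| - `|y| | <= (g + t) * `|y|.
    rewrite ler_norml /z; nra.
  have : `|x + y| - t * `|y| <= `|z + y|.
    rewrite -[X in X * _](gtr0_norm t0) -normrZ /z addrAC; exact: lerB_dist.
  rewrite /u in good; nra.
have phix_le : (phi x : R) <= `|x|.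
  exact: le_trans (ler_norm _) (dual_sphere_le x phi1).
have phixE : (phi x : R) = `|z| + t * (phi y : R).
  by rewrite -phiz /z linearB linearZ/= subrK.
have : t * (`|y| * (1 - e)) <= t * (phi y : R) by rewrite ler_pM2l.
have : 0 <= t * (2 / g * (v + u)).
  apply: mulr_ge0; first exact: ltW.
  by apply: mulr_ge0; [rewrite divr_ge0// ltW|exact: addr_ge0].
lra.
Qed.

End functionals.

(** * Order structure of a Koethe function space *)

Section kothe_lattice.
Context {d : measure_display} {S : measurableType d} {R : realType}.
Context {mu : {measure set S -> \bar R}} {E : kothe_space mu}.
Implicit Types f g phi : E.

(** [kothe_le 0 f] without the representative of 0, which vanishes only almost
    everywhere. *)
Definition kothe_nneg f := \forall t \ae mu, 0 <= rep f t.

Lemma kothe_nnegP f : kothe_le 0 f <-> kothe_nneg f.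
Proof.
by split; apply: filterS2 (rep0 E) => t ->.
Qed.

Lemma in_kothe_dominated (g : S -> R) f : measurable_fun setT g ->
  (\forall t \ae mu, `|g t| <= `|rep f t|) -> in_kothe E g.
Proof. by move=> mg /(kothe_ideal mg)[h hg _]; exists h. Qed.

Lemma repB f g : \forall t \ae mu, rep (f - g) t = rep f t - rep g t.
Proof.
apply: filterS2 (repD f (- g)) (repZ (-1) g) => t ->.
by rewrite scaleN1r => ->; rewrite mulN1r.
Qed.

Definition kothe_pos f := kothe_class E (fun t => Num.max (rep f t) 0).
Definition kothe_abs f := kothe_class E (fun t => `|rep f t|).

Lemma rep_pos f : \forall t \ae mu, rep (kothe_pos f) t = Num.max (rep f t) 0.
Proof.
apply/kothe_classP/(@in_kothe_dominated _ f).
  by apply: measurable_maxr; [exact: rep_measurable|exact: measurable_cst].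
apply: aeW => t; case: (leP (rep f t) 0) => _.
  by rewrite normr0 normr_ge0.
by [].
Qed.

Lemma rep_abs f : \forall t \ae mu, rep (kothe_abs f) t = `|rep f t|.
Proof.
apply/kothe_classP/(@in_kothe_dominated _ f).
  exact: measurableT_comp (rep_measurable f).
by apply: aeW => t; rewrite normr_id.
Qed.

Lemma kothe_norm_abs f : `|kothe_abs f| = `|f|.
Proof.
by apply/eqP; rewrite eq_le !kothe_norm_le//; apply: filterS (rep_abs f) => t ->;
  rewrite normr_id.
Qed.

Lemma kothe_pos_sublinear : sublinear (fun f : E => `|kothe_pos f|).
Proof.
split=> [f g|a f a0].
  apply: (le_trans _ (ler_normD _ _)); apply: kothe_norm_le.
  have := repD (kothe_pos f) (kothe_pos g); apply: filter_app.
  have := repD f g; apply: filter_app.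
  apply: filterS3 (rep_pos (f + g)) (rep_pos f) (rep_pos g) => t -> -> -> -> ->.
  rewrite !ger0_norm ?addr_ge0 ?le_max ?lexx ?orbT//.
  by rewrite ge_max addr_ge0 ?le_max ?lexx ?orbT// lerD ?le_max ?lexx.
rewrite -[a in leRHS]gtr0_norm// -normrZ; apply: kothe_norm_le.
have := repZ a (kothe_pos f); apply: filter_app.
apply: filterS3 (rep_pos (a *: f)) (rep_pos f) (repZ a f) => t -> -> -> ->.
by rewrite maxr_pMr ?(ltW a0)// mulr0.
Qed.

(** A linear map below [f |-> `|f^+|] is bounded by the norm, and it is positive
    because [(- f)^+ = 0] when [f] is nonnegative. *)
Lemma positive_norming_functional phi : kothe_nneg phi ->
  exists l : {linear E -> R^o}, [/\ forall f, kothe_nneg f -> 0 <= (l f : R),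
    forall f, (l f : R) <= `|f| & l phi = `|phi|].
Proof.
move=> phi0; have [l lp lphi] := hahn_banach phi kothe_pos_sublinear.
exists l; split=> [f f0|f|].
- have : (l (- f) : R) <= `|kothe_pos (- f)| by exact: lp.
  have -> : kothe_pos (- f) = 0.
    apply: rep_inj; have := rep_pos (- f); apply: filter_app.
    have := repZ (-1) f; rewrite scaleN1r; apply: filter_app.
    apply: filterS2 (rep0 E) f0 => t -> f0 -> -> _.
    by rewrite mulN1r; apply/max_idPr; rewrite oppr_le0.
  by rewrite normr0 linearN/= oppr_le0.
- apply: (le_trans (lp f)); apply: kothe_norm_le.
  apply: filterS (rep_pos f) => t ->; case: (leP (rep f t) 0) => _.
    by rewrite normr0 normr_ge0.
  by [].
- rewrite lphi; congr `|_|; apply: rep_inj.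
  by apply: filterS2 (rep_pos phi) phi0 => t -> phi0 _; apply/max_idPl.
Qed.

Lemma order_continuous_seq (u : nat -> E) : order_continuous E ->
  (forall n m, (n <= m)%N -> kothe_le (u m) (u n)) ->
  (forall n, kothe_nneg (u n)) ->
  (\forall t \ae mu, exists n, rep (u n) t <= 0) ->
  `|u n| @[n --> \oo] --> (0 : R).
Proof.
move=> oc nd u0 uex; apply/cvgrPdist_le => e e0.
have [] := oc nat (fun n m => (n <= m)%N) _ _ _ _ u nd _ _ e e0.
- exact: inhabits 0%N.
- exact: leqnn.
- by move=> i j k; exact: leq_trans.
- by move=> i j; exists (maxn i j); rewrite leq_maxl leq_maxr.
- by move=> n; exact/kothe_nnegP.
- move=> v vu; have vuT := ae_foralln vu.
  apply: filterS3 vuT uex (rep0 E) => t vut [n unt] ->.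
  exact: le_trans (vut n) unt.
- move=> N uN; exists N => // n /= Nn.
  by rewrite sub0r normrN normr_id uN.
Qed.

End kothe_lattice.

(** * Norming weights in the Koethe dual *)

Section radon_nikodym.
Context {d : measure_display} {S : measurableType d} {R : realType}.
Context {mu : {measure set S -> \bar R}} {E : kothe_space mu}.
Variables (phi : E) (l : {linear E -> R^o}).
Hypothesis oc : order_continuous E.
Hypothesis phi0 : kothe_nneg phi.
Hypothesis l0 : forall f, kothe_nneg f -> 0 <= (l f : R).
Hypothesis l1 : forall f, (l f : R) <= `|f|.

Definition kothe_cut (A : set S) : E :=
  kothe_class E (fun t => rep phi t * \1_A t).

Lemma rep_cut A : measurable A ->
  \forall t \ae mu, rep (kothe_cut A) t = rep phi t * \1_A t.
Proof.
move=> mA; apply/kothe_classP/(@in_kothe_dominated _ _ _ _ _ _ phi).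
  by apply: measurable_funM; [exact: rep_measurable|exact: measurable_indic].
apply: aeW => t; rewrite normrM indicE.
by case: (t \in A); rewrite ?normr1 ?mulr1// normr0 mulr0.
Qed.

Lemma kothe_cut_nneg A : kothe_nneg (kothe_cut A).
Proof.
have [inA|ninA] := pselect (in_kothe E (fun t => rep phi t * \1_A t)).
  apply: filterS2 (kothe_classP inA) phi0 => t; rewrite /kothe_cut => -> phi0t.
  by rewrite mulr_ge0// indicE ler0n.
rewrite /kothe_cut /kothe_class xgetPN; last first.
  by move=> f fA; apply: ninA; exists f.
by apply: filterS (rep0 E) => t ->.
Qed.

(** The measure [A |-> l (phi 1_A)] whose density represents [l]. It is real on
    non measurable sets as well, where [kothe_cut] may be 0. *)
Definition cut_measure (A : set S) : \bar R := (l (kothe_cut A) : R)%:E.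
Local Notation nu := cut_measure.

Lemma kothe_cut0 : kothe_cut set0 = 0.
Proof.
apply: rep_inj; apply: filterS2 (rep_cut measurable0) (rep0 E) => t -> -> _.
by rewrite indic0 mulr0.
Qed.

Lemma kothe_cut_null A : measurable A -> mu A = 0%E -> kothe_cut A = 0.
Proof.
move=> mA A0; apply: rep_inj.
have : \forall t \ae mu, ~ A t by exists A; split=> // t /contrapT.
apply: filterS3 (rep_cut mA) (rep0 E) => t -> -> nAt _.
by rewrite indicE memNset// mulr0.
Qed.

Lemma kothe_cutU A B : measurable A -> measurable B -> A `&` B = set0 ->
  kothe_cut (A `|` B) = kothe_cut A + kothe_cut B.
Proof.
move=> mA mB AB; apply: rep_inj.
have := repD (kothe_cut A) (kothe_cut B); apply: filter_app.
apply: filterS3 (rep_cut mA) (rep_cut mB) (rep_cut (measurableU _ _ mA mB)).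
move=> t -> -> -> -> _; rewrite -mulrDr; congr (_ * _).
rewrite !indicE in_setU.
case: (boolP (t \in A)) => tA; case: (boolP (t \in B)) => tB.
- by have : (A `&` B) t by [split; exact: set_mem]; rewrite AB.
- by rewrite addr0.
- by rewrite add0r.
- by rewrite addr0.
Qed.

Lemma kothe_cut_sum (F : nat -> set S) n : (forall i, measurable (F i)) ->
  trivIset setT F ->
  kothe_cut (\big[setU/set0]_(i < n) F i) = \sum_(i < n) kothe_cut (F i).
Proof.
move=> mF tF; elim: n => [|n IHn]; first by rewrite !big_ord0 kothe_cut0.
rewrite !big_ord_recr/= kothe_cutU ?IHn//.
  by apply: bigsetU_measurable => i _; exact: mF.
rewrite -bigcup_mkord; apply/seteqP; split=> // t [[i /= ltin Fit] Fnt].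
have in_ : i = n by apply: tF => //; exists t.
by move: ltin; rewrite in_ ltnn.
Qed.

(** The tails [phi 1_(T n)] of a countable disjoint union decrease to 0 almost
    everywhere, hence in norm by order continuity. *)
Lemma cut_measure_sigma_additive : semi_sigma_additive nu.
Proof.
move=> F mF tF mUF.
pose T n := \bigcup_n F n `\` \big[setU/set0]_(i < n) F i.
have mU n : measurable (\big[setU/set0]_(i < n) F i).
  by apply: bigsetU_measurable => i _; exact: mF.
have mT n : measurable (T n) by exact: measurableD.
have subU n : \big[setU/set0]_(i < n) F i `<=` \bigcup_n F n.
  by rewrite -bigcup_mkord => t [k _ Fkt]; exists k.
have cutT n : kothe_cut (T n) =
    kothe_cut (\bigcup_n F n) - \sum_(i < n) kothe_cut (F i).
  rewrite -kothe_cut_sum//; apply/eqP; rewrite eq_sym subr_eq -kothe_cutU//.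
    by rewrite setUC setDUK.
  by rewrite setDKI.
have T0 : `|kothe_cut (T n)| @[n --> \oo] --> (0 : R).
  apply: order_continuous_seq => //.
  - move=> n m nm; apply: filterS3 (rep_cut (mT m)) (rep_cut (mT n)) phi0.
    move=> t -> -> phit; rewrite ler_wpM2l// !indicE ler_nat.
    case: (boolP (t \in T m)) => //; rewrite in_setE => -[Ut nUt].
    rewrite (_ : t \in T n)// in_setE; split=> //; apply: contra_not nUt.
    by apply: subset_bigsetU.
  - by move=> n; exact: kothe_cut_nneg.
  - have : \forall t \ae mu, forall n,
        rep (kothe_cut (T n)) t = rep phi t * \1_(T n) t.
      by apply: ae_foralln => n; exact: rep_cut.
    apply: filterS => t Ht.
    have [[k _ Fkt]|nUt] := pselect ((\bigcup_n F n) t).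
      exists k.+1; rewrite Ht indicE memNset ?mulr0// => -[_]; apply.
      by rewrite big_ord_recr/=; right.
    by exists 0%N; rewrite Ht indicE memNset ?mulr0// => -[].
have -> : (fun n => \sum_(0 <= i < n) nu (F i))%E =
    EFin \o (fun n => (l (kothe_cut (\bigcup_n F n)) : R) -
      (l (kothe_cut (T n)) : R)).
  apply/funext => n /=; rewrite cutT linearB/= opprB addrC subrK.
  by rewrite linear_sum big_mkord /nu sumEFin.
apply: cvg_EFin; first exact: nearW.
rewrite -[X in _ --> X]subr0; apply: cvgB; first exact: cvg_cst.
apply: (@squeeze_cvgr _ _ _ _ (fun=> 0) (fun n => `|kothe_cut (T n)|)) => //.
  by apply: nearW => n; rewrite l0 ?l1//; exact: kothe_cut_nneg.
exact: cvg_cst.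
Qed.

Lemma cut_measure0 : nu set0 = 0%E.
Proof. by rewrite /nu kothe_cut0 linear0. Qed.

Lemma cut_measure_ge0 A : (0 <= nu A)%E.
Proof. by rewrite lee_fin l0//; exact: kothe_cut_nneg. Qed.

HB.instance Definition _ := isMeasure.Build d S R nu
  cut_measure0 cut_measure_ge0 cut_measure_sigma_additive.

Lemma cut_measure_fin : fin_num_fun nu.
Proof. by []. Qed.

HB.instance Definition _ := Measure_isFinite.Build d S R nu cut_measure_fin.

Lemma rep_sum_cut (r : seq R) (A : R -> set S) : (forall x, measurable (A x)) ->
  \forall t \ae mu, rep (\sum_(x <- r) x *: kothe_cut (A x)) t =
    rep phi t * \sum_(x <- r) x * \1_(A x) t.
Proof.
move=> mA; elim: r => [|x r IHr].
  by rewrite big_nil; apply: filterS (rep0 E) => t ->; rewrite big_nil mulr0.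
rewrite big_cons.
have := rep_ae (kothe_cut (A x)) (\sum_(x <- r) x *: kothe_cut (A x)) x.
apply: filter_app; apply: filterS2 IHr (rep_cut (mA x)) => t -> -> ->.
by rewrite big_cons mulrDr mulrCA.
Qed.

Import HBNNSimple.

(** The integral of a simple function [s] against [cut_measure] is [l (phi s)], so
    it is bounded by the norm of any [f] that dominates [phi s]. *)
Lemma le_sintegral_cut (s : {nnsfun S >-> R}) (f : E) :
  (forall t, `|rep phi t * s t| <= `|rep f t|) ->
  (sintegral nu s <= `|f|%:E)%E.
Proof.
move=> sf; pose A x := s @^-1` [set x].
have mA x : measurable (A x) by exact: measurable_funPTI.
rewrite sintegralE fsbig_finite//=.
pose V := finmap.enum_fset (fset_set (range s)).
pose u : E := \sum_(x <- V) x *: kothe_cut (A x).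
have -> : (\sum_(x <- V) x%:E * nu (s @^-1` [set x]))%E
    = (l u : R)%:E.
  rewrite linear_sum -sumEFin; apply: eq_bigr => x _.
  by rewrite linearZ.
rewrite lee_fin; apply: (le_trans (l1 u)); apply: kothe_norm_le.
apply: filterS (rep_sum_cut (V) mA) => t.
rewrite -/u => ->; rewrite -[X in _ * X](_ : s t = _); first exact: sf.
by rewrite fimfunE fsbig_finite.
Qed.

(** With [k] the density of [cut_measure], take [h = k / |phi|], which is 0 where
    [phi] vanishes. Then [\int |f h|] is the integral of [|f| / |phi|] against
    [cut_measure], a supremum over simple functions [s <= |f| / |phi|], to each of
    which [le_sintegral_cut] applies. *)
Lemma kothe_density : sigma_finite setT mu -> exists h : S -> R,
  [/\ measurable_fun setT h, forall t, 0 <= h t,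
      forall f : E, (\int[mu]_t `|rep f t * h t|%:E <= `|f|%:E)%E &
      (\int[mu]_t (rep phi t * h t)%:E = (l phi : R)%:E)%E].
Proof.
move=> sf.
pose sigmaF := @isSigmaFinite.Build d S R (Measure.sort mu) sf.
pose sF := @isSFinite.Build d S R (Measure.sort mu)
  (sfinite_measure_sigma_finite sf).
pose muS : {sigma_finite_measure set S -> \bar R} :=
  HB.pack (Measure.sort mu) (Measure.class mu) sF sigmaF.
have numu : nu `<< muS.
  apply/null_content_dominatesP => A mA A0.
  by rewrite /nu kothe_cut_null// linear0.
pose k := Radon_Nikodym_SigmaFinite.f nu muS.
have k0 t : (0 <= k t)%E by exact: Radon_Nikodym_SigmaFinite.f_ge0.
have kfin t : k t \is a fin_num by exact: Radon_Nikodym_SigmaFinite.f_fin_num.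
have mk : measurable_fun setT k.
  by have /integrableP[] := Radon_Nikodym_SigmaFinite.f_integrable numu.
pose g t := `|rep phi t|^-1.
have mphi : measurable_fun setT (fun t => `|rep phi t|).
  exact: measurableT_comp (rep_measurable phi).
have g0 t : 0 <= g t by rewrite invr_ge0.
have mg : measurable_fun setT g.
  (* Measurability of the inverse, through powers; both sides are 0 at 0. *)
  have -> : g = (fun t => `|rep phi t| `^ (-1)).
    by apply/funext => t; rewrite powR_inv1.
  exact: (@measurableT_comp _ _ _ _ _ _ (@powR R ^~ (-1))).
pose h t := fine (k t) * g t.
have h0 t : 0 <= h t by rewrite mulr_ge0// fine_ge0.
have intE (f : E) : (\int[mu]_t `|rep f t * h t|%:E =
    \int[nu]_t (`|rep f t| * g t)%:E)%E.
  rewrite -(Radon_Nikodym_SigmaFinite.change_of_variables numu)//; last 2 first.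
  - by move=> t; rewrite lee_fin mulr_ge0.
  - apply/measurable_EFinP; apply: measurable_funM => //.
    exact: measurableT_comp (rep_measurable f).
  apply: eq_integral => t _; rewrite -/(k t) -[k t]fineK// -EFinM; congr EFin.
  by rewrite normrM (ger0_norm (h0 t)) /h mulrA mulrAC.
have mh : measurable_fun setT h.
  apply: measurable_funM => //.
  exact: (measurableT_comp (fine_measurable measurableT) mk).
exists h; split=> // [f|].
- rewrite intE ge0_integralTE//; last by move=> t; rewrite lee_fin mulr_ge0.
  apply: ub_ereal_sup => _ [s /= sfg <-]; apply: le_sintegral_cut => t.
  have st0 : 0 <= s t by exact: fun_ge0.
  have := sfg t; rewrite lee_fin normrM (ger0_norm st0).
  move=> /(ler_wpM2l (normr_ge0 (rep phi t))) /le_trans; apply; rewrite mulrCA.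
  have [->|p0] := eqVneq (rep phi t) 0; first by rewrite normr0 mul0r mulr0.
  by rewrite mulfV ?normr_eq0// mulr1.
- have -> : (\int[mu]_t (rep phi t * h t)%:E =
      \int[mu]_t `|rep phi t * h t|%:E)%E.
    apply: ae_eq_integral => //.
    - by apply/measurable_EFinP; exact: measurable_funM (rep_measurable phi) mh.
    - apply/measurable_EFinP; apply: measurableT_comp => //.
      exact: measurable_funM (rep_measurable phi) mh.
    by apply: filterS phi0 => t p0 _; rewrite ger0_norm// mulr_ge0.
  rewrite intE; pose A := [set t | rep phi t != 0].
  have mA : measurable A.
    have -> : A = ~` (rep phi @^-1` [set 0]).
      by apply/seteqP; split=> t /= /eqP.
    apply: measurableC; rewrite -[X in measurable X]setTI.
    exact: (rep_measurable phi measurableT (measurable_set1 0)).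
  transitivity (nu A).
    rewrite -[A]setIT -integral_indic//; apply: eq_integral => t _.
    rewrite indicE /g; case: (eqVneq (rep phi t) 0) => pt.
      by rewrite pt normr0 mul0r memNset// /A/= pt eqxx.
    by rewrite mulfV ?normr_eq0// mem_set.
  rewrite /nu; congr (l _)%:E; apply: rep_inj.
  apply: filterS (rep_cut mA) => t -> _.
  rewrite indicE; case: (eqVneq (rep phi t) 0) => pt; first by rewrite pt mul0r.
  by rewrite mem_set// mulr1.
Qed.

End radon_nikodym.

Section kothe_duality.
Context {d : measure_display} {S : measurableType d} {R : realType}.
Context {mu : {measure set S -> \bar R}} {E : kothe_space mu}.
Implicit Types (f g phi : E) (h : S -> R).

Lemma kothe_norming phi : sigma_finite setT mu -> order_continuous E ->
  kothe_nneg phi -> `|phi| = 1 ->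
  exists h, [/\ forall t, 0 <= h t, kothe_dual_sphere E h &
    (\int[mu]_t (rep phi t * h t)%:E = 1)%E].
Proof.
move=> sf oc phi0 phi1.
have [l [l0 l1 lphi]] := positive_norming_functional phi0.
have [h [mh h0 fh phih]] := kothe_density oc phi0 l0 l1 sf.
rewrite lphi phi1 in phih; exists h; split=> //; split=> //.
apply/eqP; rewrite eq_le; apply/andP; split.
  apply: ub_ereal_sup => _ [f /= f1 <-]; apply: (le_trans (fh f)).
  by rewrite lee_fin.
have : (1 <= \int[mu]_t `|rep phi t * h t|%:E)%E.
  have := @le_abse_integral _ _ _ mu setT (fun t => (rep phi t * h t)%:E) measurableT.
  rewrite phih abse1; apply.
  by apply/measurable_EFinP; exact: measurable_funM (rep_measurable phi) mh.
move=> /le_trans; apply; apply: ereal_sup_ubound; exists phi => //=.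
by rewrite phi1.
Qed.

Lemma kothe_holder h f : kothe_dual_sphere E h ->
  (\int[mu]_t `|rep f t * h t|%:E <= `|f|%:E)%E.
Proof.
move=> [mh h1].
have mfh g : measurable_fun setT (fun t => `|rep g t * h t|%:E).
  apply/measurable_EFinP; apply: measurableT_comp => //.
  exact: measurable_funM (rep_measurable g) mh.
have [->|f0] := eqVneq f 0.
  rewrite normr0 (_ : (\int[mu]_t _ = 0)%E)//.
  rewrite -(integral0 mu setT); apply: ae_eq_integral => //.
  by apply: filterS (rep0 E) => t -> _; rewrite mul0r normr0.
have nf : 0 < `|f| by rewrite normr_gt0.
have : (\int[mu]_t `|rep (`|f|^-1 *: f) t * h t|%:E <= 1)%E.
  rewrite -h1; apply: ereal_sup_ubound; exists (`|f|^-1 *: f) => //=.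
  by rewrite normrZ ger0_norm ?invr_ge0// mulVf ?gt_eqF.
have -> : (\int[mu]_t `|rep (`|f|^-1 *: f) t * h t|%:E =
    (`|f|^-1)%R%:E * \int[mu]_t `|rep f t * h t|%:E)%E.
  rewrite -ge0_integralZl_EFin ?invr_ge0//.
  apply: ae_eq_integral => //; first exact: measurable_funeM.
  apply: filterS (repZ `|f|^-1 f) => t -> _.
  by rewrite -EFinM -mulrA normrM [in LHS]ger0_norm// invr_ge0.
by rewrite lee_pdivrMl// mule1.
Qed.

End kothe_duality.

(** * Uniformly rotund Koethe spaces *)

Section kothe_UR.
Context {d : measure_display} {S : measurableType d} {R : realType}.
Context {mu : {measure set S -> \bar R}} {E : kothe_space mu}.
Implicit Types f g : E.

Lemma UR_property_u_plus : UR E -> property_u_plus E.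
Proof.
move=> urE e e0; have [dl dl0 H] := UR_modulus urE e0.
exists (dl / 2) => [|f g h f1 g1 hS fg _]; first by rewrite divr_gt0.
have fge : `|f - g| <= e by apply: H => //; lra.
rewrite -lee_fin in fge; apply: (le_trans _ fge).
apply: (le_trans _ (kothe_holder (f - g) hS)).
rewrite le_eqVlt; apply/orP; left; apply/eqP.
have mh := hS.1.
apply: ae_eq_integral => //.
- apply/measurable_EFinP; apply: measurable_funM; first exact: measurableT_comp.
  by apply: measurableT_comp => //; apply: measurable_funB; exact: rep_measurable.
- apply/measurable_EFinP; apply: measurableT_comp => //.
  exact: measurable_funM (rep_measurable _) mh.
- by apply: filterS (repB f g) => t -> _; rewrite normrM mulrC.
Qed.

Lemma kothe_pos_eq0 f : kothe_pos f = 0 -> \forall t \ae mu, rep f t <= 0.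
Proof.
move=> f0; apply: filterS2 (rep_pos f) (rep0 E) => t; rewrite f0 => -> /max_idPr.
by [].
Qed.

(** For a decreasing net, [u i + u j >= 2 u j] when [j] is beyond [i]. Hence, if the
    norms stay away from 0, once [`|u i|] is close to the infimum [L] of the norms
    the midpoint of [u i] and [u j] has nearly maximal norm, and [u i], [u j] are
    close by uniform rotundity. *)
Lemma UR_order_continuous : UR E -> order_continuous E.
Proof.
move=> urE I leI [i0] lexxI letrI dirI u nd u0 uinf.
have {}u0 i : kothe_nneg (u i) by exact/kothe_nnegP.
have ndn i j : leI i j -> `|u j| <= `|u i|.
  move=> ij; apply: kothe_norm_le; apply: filterS3 (nd _ _ ij) (u0 j) (u0 i) => t.
  by move=> ? ? ?; rewrite !ger0_norm.
pose L := inf [set `|u i| | i in setT].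
have hinf : has_inf [set `|u i| | i in setT].
  by split; [exists `|u i0|; exists i0|exists 0 => _ [i _ <-]; exact: normr_ge0].
have Lle i : L <= `|u i| by apply: ge_inf; [exact: hinf.2|exists i].
have tail e : 0 < e -> exists i, forall j, leI i j -> `|u i - u j| <= e.
  move=> e0; have [[i ui]|noi] := pselect (exists i, `|u i| <= e / 2).
    exists i => j ij; apply: (le_trans (ler_normB _ _)).
    by have := ndn _ _ ij; lra.
  have {noi} ui i : e / 2 < `|u i|.
    by rewrite ltNge; apply/negP => ui; apply: noi; exists i.
  have L0 : 0 < L.
    apply: (@lt_le_trans _ _ (e / 2)); first by rewrite divr_gt0.
    by apply: lb_le_inf; [exact: hinf.1|move=> _ [i _ <-]; exact: ltW].
  have M0 : 0 < `|u i0| by exact: lt_le_trans (Lle i0).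
  have [dl dl0 H] := UR_modulus_ball urE (divr_gt0 e0 M0).
  (* [L * (dl / 2)] is small enough since [(1 + dl / 2) * (1 - dl / 2) <= 1]. *)
  have [_ [i1 _ <-] ui1] := inf_adherent (mulr_gt0 L0 (divr_gt0 dl0 (ltr0Sn _ 1))) hinf.
  have [i [i0i i1i]] := dirI i0 i1; exists i => j ij.
  have a0 : 0 < `|u i| by exact: lt_le_trans (Lle i).
  have aL : `|u i| <= L + L * (dl / 2).
    by apply: (le_trans (ndn _ _ i1i)); rewrite ltW.
  have := H (`|u i|^-1 *: u i) (`|u i|^-1 *: u j).
  rewrite -scalerDr -scalerBr !normrZ !(ger0_norm (ltW _)) ?invr_gt0//.
  rewrite mulVf ?gt_eqF// !ler_pdivrMl// mulr1 ler_pdivlMl// => /(_ erefl (ndn _ _ ij)).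
  have uij : `|u j| * 2 <= `|u i + u j|.
    have -> : `|u j| * 2 = `|2 *: u j| by rewrite normrZ ger0_norm// mulrC.
    apply: kothe_norm_le; have := repD (u i) (u j); apply: filter_app.
    have := repZ 2 (u j); apply: filter_app.
    apply: filterS3 (nd _ _ ij) (u0 i) (u0 j) => t ? ? ? -> ->.
    by rewrite !ger0_norm ?addr_ge0 ?mulr_ge0//; lra.
  have aj : `|u i| * (2 - dl) <= `|u i + u j|.
    have := Lle j; nra.
  move=> /(_ aj) /le_trans; apply; have := ndn _ _ i0i => ai.
  by rewrite mulrA ler_pdivrMr// mulrC ler_pM2l.
pose F : set_system E := [set A | exists i, forall j, leI i j -> A (u j)].
have FF : ProperFilter F.
  split; first by move=> [i /(_ i (lexxI i))].
  split; first by exists i0.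
  - move=> A B [i Ai] [j Bj]; have [k [ik jk]] := dirI i j.
    exists k => m km; split; first by apply: Ai; exact: letrI km.
    by apply: Bj; exact: letrI km.
  - by move=> A B AB [i Ai]; exists i => j /Ai /AB.
have Fc : cauchy F.
  apply: cauchy_exP => e e0; have e20 : 0 < e / 2 by rewrite divr_gt0.
  have [i ui] := tail _ e20; exists (u i), i => j ij.
  rewrite -ball_normE/=; apply: (le_lt_trans (ui j ij)); lra.
have /cvg_ex[v Fv] : cvg F by exact: cauchy_cvg.
have vF e : 0 < e -> exists i, forall j, leI i j -> `|v - u j| <= e.
by move=> e0; have := @cvgr_dist_le _ _ _ F FF id v Fv e e0.
have v_eq0 (w : E) : (forall e, 0 < e -> `|w| <= e) -> w = 0.
  move=> we; apply/eqP; rewrite -normr_le0; apply/ler_addgt0Pr => e e0.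
  by rewrite add0r we.
(* Order intervals are closed: [(v - u i)^+ <= |v - u k|] for [k] beyond [i]. *)
have vu i : kothe_le v (u i).
  have : kothe_pos (v - u i) = 0.
    apply: v_eq0 => e e0; have [j uj] := vF _ e0; have [k [ik jk]] := dirI i j.
    apply: (le_trans _ (uj k jk)); apply: kothe_norm_le.
    have := repB v (u k); apply: filter_app.
    apply: filterS3 (nd _ _ ik) (repB v (u i)) (rep_pos (v - u i)) => t uki -> -> ->.
    rewrite ger0_norm ?le_max ?lexx ?orbT// ge_max normr_ge0 andbT.
    by apply: le_trans (ler_norm _); lra.
  move=> /kothe_pos_eq0; apply: filterS2 (repB v (u i)) => t ->.
  by rewrite subr_le0.
have v0 : v = 0.
  have vle := uinf _ vu.
  have : kothe_pos (- v) = 0.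
    apply: v_eq0 => e e0; have [j uj] := vF _ e0.
    apply: (le_trans _ (uj j (lexxI j))); apply: kothe_norm_le.
    have := repB v (u j); apply: filter_app.
    have := repZ (-1) v; rewrite scaleN1r; apply: filter_app.
    apply: filterS2 (u0 j) (rep_pos (- v)) => t uj0 -> -> ->.
    rewrite ger0_norm ?le_max ?lexx ?orbT// ge_max normr_ge0 andbT.
    by rewrite -normrN; apply: le_trans (ler_norm _); lra.
  move=> /kothe_pos_eq0 vge; apply: rep_inj.
  have := repZ (-1) v; rewrite scaleN1r; apply: filter_app.
  apply: filterS3 vle vge (rep0 E) => t vle vge r0 vE _.
  rewrite r0 in vle *; rewrite vE in vge.
  by apply/eqP; rewrite eq_le; lra.
move=> e e0; have [i ui] := vF _ e0; exists i => j ij.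
by have := ui j ij; rewrite v0 sub0r normrN.
Qed.

End kothe_UR.

(** * Integration against a nonnegative weight *)

Section kothe_pairing.
Context {d : measure_display} {S : measurableType d} {R : realType}.
Context {mu : {measure set S -> \bar R}} {E : kothe_space mu}.
Variable h : S -> R.
Hypothesis h0 : forall t, 0 <= h t.
Hypothesis hS : kothe_dual_sphere E h.
Implicit Types f g : E.

Definition kothe_pair f : R := \int[mu]_t (rep f t * h t).

Lemma kothe_pair_measurable f : measurable_fun setT (fun t => rep f t * h t).
Proof. exact: measurable_funM (rep_measurable f) hS.1. Qed.

Lemma kothe_pair_integrable f :
  mu.-integrable setT (EFin \o (fun t => rep f t * h t)).
Proof.
apply/integrableP; split.
  by apply/measurable_EFinP; exact: kothe_pair_measurable.
by apply: (le_lt_trans (kothe_holder f hS)); exact: ltry.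
Qed.

Lemma kothe_pairE f : (\int[mu]_t (rep f t * h t)%:E = (kothe_pair f)%:E)%E.
Proof.
rewrite fineK//; apply: integrable_fin_num => //; exact: kothe_pair_integrable.
Qed.

Lemma kothe_pair_linear (a : R) f g :
  kothe_pair (a *: f + g) = a * kothe_pair f + kothe_pair g.
Proof.
have if_ := kothe_pair_integrable f; have ig := kothe_pair_integrable g.
rewrite -RintegralZl// -RintegralD//; last first.
  by have := @integrableZl _ _ _ mu _ measurableT a _ if_.
congr fine; apply: ae_eq_integral => //.
- by apply/measurable_EFinP; exact: kothe_pair_measurable.
- apply/measurable_EFinP; apply: measurable_funD; last exact: kothe_pair_measurable.
  by apply: measurable_funM => //; exact: kothe_pair_measurable.
by apply: filterS (rep_ae f g a) => t -> _; rewrite mulrDl mulrA.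
Qed.

Lemma kothe_pair0 : kothe_pair 0 = 0.
Proof.
by have := kothe_pair_linear (-1) 0 0; rewrite scaler0 addr0 mulN1r addNr.
Qed.

Lemma kothe_pair_ge0 f : kothe_nneg f -> 0 <= kothe_pair f.
Proof.
move=> f0; rewrite -lee_fin -kothe_pairE.
have -> : (\int[mu]_t (rep f t * h t)%:E = \int[mu]_t `|rep f t * h t|%:E)%E.
  apply: ae_eq_integral => //.
  - by apply/measurable_EFinP; exact: kothe_pair_measurable.
  - apply/measurable_EFinP; apply: measurableT_comp => //.
    exact: kothe_pair_measurable.
  by apply: filterS f0 => t f0 _; rewrite ger0_norm// mulr_ge0.
by apply: integral_ge0 => t _; rewrite lee_fin.
Qed.

Lemma kothe_pair_le_norm f : kothe_pair f <= `|f|.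
Proof.
apply: (le_trans (ler_norm _)).
rewrite -lee_fin; apply: (le_trans _ (kothe_holder f hS)).
rewrite -abse_EFin -kothe_pairE; apply: le_abse_integral => //.
by apply/measurable_EFinP; exact: kothe_pair_measurable.
Qed.

Lemma kothe_pair_abs_le f g (e : R) :
  (\int[mu]_t (`|h t| * `|rep f t - rep g t|)%:E <= e%:E)%E ->
  kothe_pair (kothe_abs (f - g)) <= e.
Proof.
move=> fge; rewrite -lee_fin -kothe_pairE; apply: (le_trans _ fge).
rewrite le_eqVlt; apply/orP; left; apply/eqP.
apply: ae_eq_integral => //.
- by apply/measurable_EFinP; exact: kothe_pair_measurable.
- apply/measurable_EFinP; apply: measurable_funM.
    exact: measurableT_comp hS.1.
  by apply: measurableT_comp => //; apply: measurable_funB; exact: rep_measurable.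
apply: filterS2 (rep_abs (f - g)) (repB f g) => t -> -> _.
by rewrite mulrC (ger0_norm (h0 t)).
Qed.

(** A linear inequality is given by the list of its terms, so that representatives,
    which are linear only almost everywhere, are expanded once and for all. *)
Lemma kothe_pair_comb_ge0 (r : seq (R * E)) :
  (\forall t \ae mu, 0 <= \sum_(x <- r) x.1 * rep x.2 t) ->
  0 <= \sum_(x <- r) x.1 * kothe_pair x.2.
Proof.
move=> r0.
have -> : \sum_(x <- r) x.1 * kothe_pair x.2 = kothe_pair (\sum_(x <- r) x.1 *: x.2).
  elim: {r0}r => [|x r IHr]; first by rewrite !big_nil kothe_pair0.
  by rewrite !big_cons kothe_pair_linear IHr.
apply: kothe_pair_ge0.
have : \forall t \ae mu,
    rep (\sum_(x <- r) x.1 *: x.2) t = \sum_(x <- r) x.1 * rep x.2 t.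
  elim: {r0}r => [|x r IHr].
    by rewrite big_nil; apply: filterS (rep0 E) => t ->; rewrite big_nil.
  rewrite big_cons; apply: filterS2 IHr (rep_ae x.2 (\sum_(x <- r) x.1 *: x.2) x.1).
  by move=> t IH ->; rewrite big_cons IH.
by apply: filterS2 r0 => t + ->.
Qed.

(** Integrates against [h] the inequality that [uacs_slope] gives pointwise for the
    moduli [a], [b], [c *: p], [m *: w] of [F], [G], [F - t *: G], [F + G]. As
    [p] is normed by [h], it serves as a common reference: the error term
    [|a - b| + (a + b - m w)] is small once [a], [b] and [w] are all close to [p]
    in [L^1(h)]. *)
Lemma kothe_pair_slope (a b p w : E) (c m t K e eta : R) :
  0 < t -> 0 < K -> e <= 1 -> m <= 2 -> `|a| <= 1 -> `|w| <= 1 ->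
  kothe_pair p = 1 -> kothe_pair (kothe_abs (p - a)) <= 2 * t ->
  kothe_pair (kothe_abs (p - b)) <= eta ->
  kothe_pair (kothe_abs (p - w)) <= eta ->
  (\forall x \ae mu, t * ((1 - e) * rep b x -
      K * (`|rep a x - rep b x| + (rep a x + rep b x - m * rep w x))) <=
    rep a x - c * rep p x) ->
  c <= 1 - t * ((1 - e) * (1 - eta) - K * (4 * t + 4 * eta + (2 - m))).
Proof.
move=> t0 K0 e1 m2 a1 w1 Lp Lpa Lpb Lpw slope.
have Lb : 1 - eta <= kothe_pair b.
  have : 0 <= \sum_(x <- [:: (1, b); (-1, p); (1, kothe_abs (p - b))])
      x.1 * kothe_pair x.2.
    apply: kothe_pair_comb_ge0.
    apply: filterS2 (rep_abs (p - b)) (repB p b) => x r1 r2.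
    rewrite !big_cons big_nil/= r1 r2.
    by have := ler_norm (rep p x - rep b x); lra.
  by rewrite !big_cons big_nil/= Lp; lra.
(* [slope] with its error term bounded by
   [2 |p - a| + 2 |p - b| + 2 |p - w| + (2 - m) w]. *)
have : 0 <= \sum_(x <- [:: (1, a); (- c, p); (- (t * (1 - e)), b);
    (2 * t * K, kothe_abs (p - a)); (2 * t * K, kothe_abs (p - b));
    (2 * t * K, kothe_abs (p - w)); (t * K * (2 - m), w)]) x.1 * kothe_pair x.2.
  apply: kothe_pair_comb_ge0.
  have := repB p a; apply: filter_app; have := repB p b; apply: filter_app.
  have := repB p w; apply: filter_app; have := rep_abs (p - a); apply: filter_app.
  have := rep_abs (p - b); apply: filter_app.
  apply: filterS2 (rep_abs (p - w)) slope => x r1 slopex r2 r3 r4 r5 r6.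
  rewrite !big_cons big_nil/= r1 r2 r3 r4 r5 r6 {r1 r2 r3 r4 r5 r6}.
  move: slopex.
  move: (rep a x) (rep b x) (rep p x) (rep w x) => ax bx px wx slopex.
  have A1 := ler_norm (px - ax); have A2 := ler_norm (ax - px).
  have B1 := ler_norm (px - bx); have B2 := ler_norm (bx - px).
  have W1 := ler_norm (px - wx).
  rewrite [`|ax - px|]distrC in A2; rewrite [`|bx - px|]distrC in B2.
  have ab : `|ax - bx| <= `|px - ax| + `|px - bx| by rewrite ler_norml; lra.
  have DA : `|ax - bx| + (ax + bx - m * wx) <=
      2 * `|px - ax| + 2 * `|px - bx| + 2 * `|px - wx| + (2 - m) * wx by lra.
  have := ler_wpM2l (ltW (mulr_gt0 t0 K0)) DA; lra.
rewrite !big_cons big_nil/= Lp.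
have mw : (2 - m) * kothe_pair w <= 2 - m.
  rewrite -[leRHS]mulr1 ler_wpM2l ?subr_ge0//.
  exact: le_trans (kothe_pair_le_norm w) w1.
have La := le_trans (kothe_pair_le_norm a) a1.
have Kb : t * ((1 - e) * (1 - eta)) <= t * ((1 - e) * kothe_pair b).
  by rewrite ler_pM2l// ler_wpM2l// subr_ge0.
have : t * K * (2 * kothe_pair (kothe_abs (p - a)) +
    2 * kothe_pair (kothe_abs (p - b)) + 2 * kothe_pair (kothe_abs (p - w)) +
    (2 - m) * kothe_pair w) <= t * K * (4 * t + 4 * eta + (2 - m)).
  by rewrite ler_pM2l ?mulr_gt0//; lra.
move: La Kb; move: (kothe_pair a) (kothe_pair b) (kothe_pair w) => La Lb' Lw.
lra.
Qed.

End kothe_pairing.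

(** * The Koethe-Bochner space *)

Section kothe_bochner_uacs.
Context {d : measure_display} {S : measurableType d} {R : realType}.
Context {mu : {measure set S -> \bar R}} {E : kothe_space mu}.
Context {X : completeNormedModType R}.
Implicit Types F G : kothe_bochner E X.

Definition kb_modulus F : E := kothe_class E (fun t => `|repr F t|).

Lemma rep_modulus F : \forall t \ae mu, rep (kb_modulus F) t = `|repr F t|.
Proof. exact: kothe_class_repr. Qed.

Lemma repr_comb a F G : \forall t \ae mu,
  repr (F + a *: G) t = repr F t + a *: repr G t.
Proof. by apply: filterS2 (repr_add F (a *: G)) (repr_scale a G) => t -> ->. Qed.

(** The unit vectors [b] and [w], the normalized modulus of [F + G], are compared
    with [p], the normalized modulus of [F - t *: G], by property (u+), which needs
    lower bounds for the norms of [p + b] and [p + w]. *)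
Lemma slope_kothe_bochner (e t K eta dl dE : R) F G :
  sigma_finite setT mu -> order_continuous E ->
  0 < K -> e <= 1 -> 0 < t -> t <= 1 / 2 -> dl <= 1 -> t <= dE / 2 -> dl <= dE / 2 ->
  (forall x y : X, t * ((1 - e) * `|y| - K * (`| `|x| - `|y| | + (`|x| + `|y| - `|x + y|)))
      <= `|x| - `|x - t *: y| ) ->
  (forall (f g : E) (h : S -> R),
      `|f| = 1 -> `|g| = 1 -> kothe_dual_sphere E h ->
      `|f + g| >= 2 * (1 - dE) ->
      (\int[mu]_t (rep f t * h t)%:E = 1)%E ->
      (\int[mu]_t (`|h t| * `|rep f t - rep g t|)%:E <= eta%:E)%E) ->
  `|F| = 1 -> `|G| = 1 -> 2 - dl <= `|F + G| ->
  `|F - t *: G| <= 1 - t * ((1 - e) * (1 - eta) - K * (4 * t + 4 * eta + dl)).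
Proof.
move=> sf oc K0 e1 t0 t1 dl1 tdE dldE slopeX uE F1 G1 FG.
set a := kb_modulus F; set b := kb_modulus G.
set c := kb_modulus (F - t *: G); set s := kb_modulus (F + G).
set c1 := `|F - t *: G|; set m := `|F + G|.
have a1 : `|a| = 1 by []. have b1 : `|b| = 1 by [].
have ra := rep_modulus F; have rb := rep_modulus G.
have rc : \forall x \ae mu, rep c x = `|repr F x - t *: repr G x|.
  apply: filterS2 (rep_modulus (F - t *: G)) (repr_comb (- t) F G) => x ->.
  by rewrite scaleNr => ->; rewrite scaleNr.
have rs : \forall x \ae mu, rep s x = `|repr F x + repr G x|.
  by apply: filterS2 (rep_modulus (F + G)) (repr_add F G) => x -> ->.
have tG : `|t *: G| = t by rewrite normrZ G1 mulr1 gtr0_norm.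
have c1le : c1 <= 1 + t by rewrite -F1 -[in leRHS]tG; exact: ler_normB.
have c1ge : 1 - t <= c1 by rewrite -F1 -[in leLHS]tG; exact: lerB_dist.
have mle : m <= 2 by rewrite (le_trans (ler_normD _ _))// F1 G1.
have c0 : 0 < c1 by lra.
have m0 : 0 < m by rewrite /m; lra.
pose p := c1^-1 *: c; pose w := m^-1 *: s.
have p1 : `|p| = 1 by rewrite normrZ gtr0_norm ?invr_gt0// mulVf ?gt_eqF.
have w1 : `|w| = 1 by rewrite normrZ gtr0_norm ?invr_gt0// mulVf ?gt_eqF.
have cE : c = c1 *: p by rewrite scalerA mulfV ?gt_eqF// scale1r.
have sE : s = m *: w by rewrite scalerA mulfV ?gt_eqF// scale1r.
have rcp : \forall x \ae mu, rep c x = c1 * rep p x by have := repZ c1 p; rewrite -cE.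
have rsw : \forall x \ae mu, rep s x = m * rep w x by have := repZ m w; rewrite -sE.
have cp : `|c - p| <= t.
  rewrite cE -[X in _ - X]scale1r -scalerBl normrZ p1 mulr1 ler_norml; lra.
have sw : `|2^-1 *: s - w| = 1 - m / 2.
  rewrite sE scalerA -[X in _ - X]scale1r -scalerBl normrZ w1 mulr1.
  by rewrite ler0_norm; lra.
have ac : `|a - c| <= t.
  have -> : t = `|t *: b| by rewrite normrZ b1 mulr1 gtr0_norm.
  apply: kothe_norm_le; have := repZ t b; apply: filter_app.
  have := repB a c; apply: filter_app.
  apply: filterS3 ra rb rc => x -> -> -> -> ->.
  rewrite normrM normr_id -normrZ.
  by have := ler_dist_dist (repr F x) (repr F x - t *: repr G x); rewrite subKr.
(* [F + G] is [F - t *: G] plus [(1 + t) *: G]. *)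
have pb : 2 * (1 - dE) <= `|p + b|.
  have : m <= `|c + (1 + t) *: b|.
    apply: kothe_norm_le; have := repD c ((1 + t) *: b); apply: filter_app.
    have := repZ (1 + t) b; apply: filter_app.
    apply: filterS3 rs rb rc => x -> -> -> -> ->.
    rewrite normr_id [leRHS]ger0_norm; last by rewrite addr_ge0// mulr_ge0//; lra.
    have -> : repr F x + repr G x = (repr F x - t *: repr G x) + (1 + t) *: repr G x.
      by rewrite scalerDl scale1r [_ + t *: _]addrC addrA subrK.
    by apply: (le_trans (ler_normD _ _)); rewrite normrZ (@ger0_norm _ (1 + t))//; lra.
  have : `|c + (1 + t) *: b| <= `|p + b| + `|c - p| + t.
    have -> : c + (1 + t) *: b = (p + b) + (c - p) + t *: b.
      by rewrite scalerDl scale1r addrA; congr (_ + _); rewrite [RHS]addrC addrA subrK.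
    apply: (le_trans (ler_normD _ _)); rewrite normrZ b1 mulr1 gtr0_norm// lerD2r.
    exact: ler_normD.
  rewrite /m; lra.
(* [(3 / 2) *: (F + G)] is [F - t *: G] plus [2^-1 *: (F + G)] plus
   [(1 + t) *: G], and [2^-1 *: s] is close to [w] since [m] is close to 2. *)
have pw : 2 * (1 - dE) <= `|p + w|.
  have : `|(3 / 2) *: s| <= `|c + 2^-1 *: s + (1 + t) *: b|.
    apply: kothe_norm_le; have := repD (c + 2^-1 *: s) ((1 + t) *: b); apply: filter_app.
    have := repD c (2^-1 *: s); apply: filter_app.
    have := repZ 2^-1 s; apply: filter_app.
    have := repZ (3 / 2) s; apply: filter_app.
    have := repZ (1 + t) b; apply: filter_app.
    apply: filterS3 rs rb rc => x -> -> -> -> -> -> -> ->.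
    rewrite normrM normr_id ger0_norm; last lra.
    rewrite [leRHS]ger0_norm; last by rewrite !addr_ge0// mulr_ge0//; lra.
    have : `|repr F x + repr G x| <= `|repr F x - t *: repr G x| + (1 + t) * `|repr G x|.
      rewrite -[X in X * _](@ger0_norm _ (1 + t)); last lra.
      rewrite -normrZ.
      have := ler_normD (repr F x - t *: repr G x) ((1 + t) *: repr G x).
      by rewrite scalerDl scale1r [_ + t *: _]addrC addrA subrK.
    lra.
  have -> : `|(3 / 2) *: s| = 3 / 2 * m by rewrite normrZ ger0_norm//; lra.
  have : `|c + 2^-1 *: s + (1 + t) *: b| <= `|c + 2^-1 *: s| + (1 + t).
    apply: (le_trans (ler_normD _ _)); rewrite [X in _ + X <= _]normrZ b1 mulr1.
    by rewrite (@ger0_norm _ (1 + t))//; lra.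
  have : `|c + 2^-1 *: s| <= `|p + w| + (`|c - p| + `|2^-1 *: s - w|).
    have -> : c + 2^-1 *: s = (p + w) + ((c - p) + (2^-1 *: s - w)).
      by rewrite addrACA ![_ + (_ - _)]addrC !subrK.
    apply: (le_trans (ler_normD _ _)); rewrite lerD2l; exact: ler_normD.
  rewrite sw /m; lra.
have p0 : kothe_nneg p.
  apply: filterS2 (repZ c1^-1 c) rc => x -> ->.
  by rewrite mulr_ge0// invr_ge0 ltW.
have [h [h0 hS ph]] := kothe_norming sf oc p0 p1.
have slope : \forall x \ae mu, t * ((1 - e) * rep b x -
      K * (`|rep a x - rep b x| + (rep a x + rep b x - m * rep w x))) <=
    rep a x - c1 * rep p x.
  have := rsw; apply: filter_app; have := rcp; apply: filter_app.
  have := rs; apply: filter_app; apply: filterS3 ra rb rc => x ax bx cx sx cpx swx.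
  have := slopeX (repr F x) (repr G x).
  by rewrite -ax -bx -cx -sx swx cpx.
have pa : kothe_pair h (kothe_abs (p - a)) <= 2 * t.
  apply: (le_trans (kothe_pair_le_norm hS _)); rewrite kothe_norm_abs.
  have -> : p - a = (p - c) + (c - a) by rewrite addrA subrK.
  apply: (le_trans (ler_normD _ _)).
  by rewrite [`|p - c|]distrC [`|c - a|]distrC mulr2n mulrDl mul1r lerD.
have hp : kothe_pair h p = 1 by apply: EFin_inj; rewrite -(kothe_pairE hS).
have hpb : kothe_pair h (kothe_abs (p - b)) <= eta.
  by apply: kothe_pair_abs_le => //; exact: uE.
have hpw : kothe_pair h (kothe_abs (p - w)) <= eta.
  by apply: kothe_pair_abs_le => //; exact: uE.
have m2 : 2 - m <= dl by rewrite lerBlDr addrC -lerBlDr.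
have a1' : `|a| <= 1 by rewrite a1.
have w1' : `|w| <= 1 by rewrite w1.
apply: (le_trans (kothe_pair_slope h0 hS t0 K0 e1 mle a1' w1' hp pa hpb hpw slope)).
by rewrite lerD2l lerN2 ler_pM2l// lerD2l lerN2 ler_pM2l// lerD2l.
Qed.

(** The order of choices matters: [K] comes from X, the accuracy [eta] in property
    (u+) is chosen small with respect to [K], and only then [t] and [dl] are chosen
    small with respect to [K] and to the modulus [dE] that (u+) assigns to [eta]. *)
Theorem uacs_kothe_bochner : sigma_finite setT mu -> order_continuous E ->
  property_u_plus E -> uacs X -> uacs (kothe_bochner E X).
Proof.
move=> sf oc uE uX; apply: uacs_of_slope => e e0.
have e10 : 0 < Num.min (e / 4) 1 by rewrite lt_min ltr01 divr_gt0.
have [t0 [K [t00 K0 HX]]] := uacs_slope uX e10.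
set e1 := Num.min _ _ in e10 HX.
have [e1e e11] : e1 <= e / 4 /\ e1 <= 1 by rewrite /e1 !ge_min !lexx orbT.
have K1 : 0 < 4 * (1 + 4 * K) by lra.
pose eta := e / (4 * (1 + 4 * K)).
have eta0 : 0 < eta by rewrite divr_gt0.
have etaE : 4 * (1 + 4 * K) * eta = e by rewrite mulrC divfK ?gt_eqF.
have [dE dE0 HE] := uE eta eta0.
pose t := Num.min (Num.min t0 (1 / 2)) (Num.min (dE / 2) (e / 16 / K)).
have [tt0 t1 tdE tK] : [/\ t <= t0, t <= 1 / 2, t <= dE / 2 & t <= e / 16 / K].
  by rewrite /t !ge_min !lexx ?orbT.
have tpos : 0 < t by rewrite !lt_min t00 !divr_gt0.
pose dl := Num.min 1 (Num.min (dE / 2) (e / 4 / K)).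
have [d1 ddE dK] : [/\ dl <= 1, dl <= dE / 2 & dl <= e / 4 / K].
  by rewrite /dl !ge_min !lexx ?orbT.
have dpos : 0 < dl by rewrite !lt_min ltr01 !divr_gt0.
exists t, dl; split=> // F G F1 G1 FG.
have := slope_kothe_bochner sf oc K0 e11 tpos t1 d1 tdE ddE _ HE F1 G1 FG.
move=> /(_ (fun x y => HX x y t tpos tt0))/le_trans; apply.
rewrite lerD2l lerN2 ler_pM2l//.
rewrite ler_pdivlMr// in tK; rewrite ler_pdivlMr// in dK.
have : 0 <= e1 * eta by rewrite mulr_ge0// ltW.
lra.
Qed.

End kothe_bochner_uacs.

Theorem theorem3p12 (R : realType) (d : measure_display) (S : measurableType d)
    (mu : {measure set S -> \bar R}) (E : kothe_space mu)
    (X : completeNormedModType R) :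
  measure_is_complete mu -> sigma_finite setT mu ->
  (UR E -> order_continuous E /\ property_u_plus E) /\
  (order_continuous E -> property_u_plus E -> uacs X ->
   uacs (kothe_bochner E X)).
Proof.
move=> _ sf; split=> [urE|oc uE uX].
  by split; [exact: UR_order_continuous|exact: UR_property_u_plus].
exact: uacs_kothe_bochner.
Qed.
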